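(* Let $L=(L_t)_{t\ge 0}$ be a real-valued Lévy process satisfying the sector condition. Assume that $L$ is locally symmetric and self-similar (LSS), has Blumenthal--Getoor index $\beta\in(0,2]$, and that $L_1$ has a finite absolute moment $\mathbb{E}[|L_1|^p]<\infty$ for some $p>0$. Then the differential entropy $h(L_t)$ is finite for all $t>0$ and $$h(L_t)=\frac1\beta\log t+h(Y_\beta)+o_t(1),$$ where $Y_\beta$ is a symmetric-$\alpha$-stable (S$\alpha$S) random variable with $\alpha=\beta$ and $o_t(1)\to 0$ when $t\to 0^+$.
   Context: A Lévy process $L$ has $L_0=0$ a.s., stationary independent increments, and a.s. right-continuous paths with left limits. Its characteristic exponent $\Psi:\mathbb{R}\to\mathbb{C}$ is the continuous function with $\mathbb{E}[e^{i\xi L_t}]=\exp(t\Psi(\xi))$ for all $t\ge0$, $\xi\in\mathbb{R}$. Sector condition: there is a constant $C>0$ such that $|\Im\Psi(\xi)|\le C|\Re\Psi(\xi)|$ for all $\xi\in\mathbb{R}$. Blumenthal--Getoor index: $\beta=\inf\{p>0:\ |\Psi(\xi)|/|\xi|^p\to 0\text{ as }|\xi|\to\infty\}\in[0,2]$. A random process $X=(X_t)_{t\ge0}$ is locally self-similar of order $H\in\mathbb{R}$ if the rescaled process $(a^H X_{t/a})_{t\ge0}$ converges in law to a non-trivial random process $Y$ when $a\to\infty$. If moreover the limiting process $Y$ is symmetric, i.e. $Y$ and $-Y$ have the same probability law, then $X$ is called locally symmetric and self-similar (LSS). A random variable is symmetric-$\alpha$-stable (S$\alpha$S), $\alpha\in(0,2]$,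 if its characteristic function is $\xi\mapsto\exp(-\gamma|\xi|^\alpha)$ for some $\gamma>0$. For an absolutely continuous real random variable $X$ with density $p_X$, the differential entropy is $h(X)=-\int_{\mathbb{R}}p_X(x)\log p_X(x)\,dx$ (convention $0\log 0=0$). It is said to be finite when $X$ is absolutely continuous and the integrand is absolutely integrable. *)

(* Defs.v *)
From HB Require Import structures.
From mathcomp Require Import all_boot all_order all_algebra.
From mathcomp Require Import all_classical all_reals all_analysis.
From mathcomp Require Import complex.
Import Order.TTheory GRing.Theory Num.Theory.
Import numFieldNormedType.Exports.

Set Implicit Arguments.
Unset Strict Implicit.
Unset Printing Implicit Defensive.

Local Open Scope classical_set_scope.
Local Open Scope complex_scope.
Local Open Scope ring_scope.

Definition cexp (R : realType) (z : R[i]) : R[i] :=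
  (expR (complex.Re z) * cos (complex.Im z)) +i*
  (expR (complex.Re z) * sin (complex.Im z)).

(* E[e^{i xi X}] = E[cos (xi X)] + i E[sin (xi X)] *)
Definition charfun (R : realType) d (T : measurableType d)
    (P : probability T R) (X : T -> R) (xi : R) : R[i] :=
  (\int[P]_w cos (xi * X w)) +i* (\int[P]_w sin (xi * X w)).

Definition same_law (R : realType) d1 d2 d' (T1 : measurableType d1)
    (T2 : measurableType d2) (T' : measurableType d')
    (P1 : probability T1 R) (X1 : T1 -> T')
    (P2 : probability T2 R) (X2 : T2 -> T') : Prop :=
  forall A : set T', measurable A -> P1 (X1 @^-1` A) = P2 (X2 @^-1` A).

(* Throughout, a process indexed by [0, +oo[ is a family of random variables
   indexed by R, of which only the members with nonnegative index matter. *)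

(* The sets A i may be setT, so the product rule over all n increments
   contains the one over each subfamily. *)
Definition independent_increments (R : realType) d (T : measurableType d)
    (P : probability T R) (L : R -> {RV P >-> R}) : Prop :=
  forall (n : nat) (t : nat -> R) (A : nat -> set R),
    0 <= t 0%N -> (forall i, t i <= t i.+1) -> (forall i, measurable (A i)) ->
    P (\bigcap_(i in `I_n) [set w | A i (L (t i.+1) w - L (t i) w)]) =
    (\prod_(i < n) P [set w | A i (L (t i.+1) w - L (t i) w)%R])%E.

Definition stationary_increments (R : realType) d (T : measurableType d)
    (P : probability T R) (L : R -> {RV P >-> R}) : Prop :=
  forall s t : R, 0 <= s -> s <= t ->
    same_law P (fun w => L t w - L s w) P (L (t - s)).

Definition cadlag (R : realType) (x : R -> R) : Prop :=
  (forall t, 0 <= t -> x s @[s --> t^'+] --> x t) /\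
  (forall t, 0 < t -> cvg (x s @[s --> t^'-])).

Record levy_process (R : realType) d (T : measurableType d)
    (P : probability T R) (L : R -> {RV P >-> R}) : Prop := LevyProcess {
  levy_start : {ae P, forall w, L 0 w = 0} ;
  levy_independent : independent_increments L ;
  levy_stationary : stationary_increments L ;
  levy_cadlag : {ae P, forall w, cadlag (fun t => L t w)} }.

Definition characteristic_exponent (R : realType) d (T : measurableType d)
    (P : probability T R) (L : R -> {RV P >-> R}) (Psi : R -> R[i]) : Prop :=
  continuous (Psi : R -> R[i]^o) /\
  forall t xi : R, 0 <= t -> charfun P (L t) xi = cexp (t%:C * Psi xi).

Definition sector_condition (R : realType) (Psi : R -> R[i]) : Prop :=
  exists2 C : R, 0 < C &
    forall xi, `|complex.Im (Psi xi)| <= C * `|complex.Re (Psi xi)|.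

Definition BG_index (R : realType) (Psi : R -> R[i]) : R :=
  inf [set p : R | [/\ 0 < p,
    Normc.normc (Psi xi) / `|xi| `^ p @[xi --> +oo] --> (0 : R) &
    Normc.normc (Psi xi) / `|xi| `^ p @[xi --> -oo] --> (0 : R)]].

(* Convergence in law of the processes X a, as a tends to +oo, is convergence
   of the finite-dimensional marginals at all nonnegative times. *)
Definition process_cvg_in_law (R : realType) d d' (T : measurableType d)
    (T' : measurableType d') (P : probability T R) (X : R -> R -> T -> R)
    (Q : probability T' R) (Y : R -> T' -> R) : Prop :=
  forall (n : nat) (t : 'I_n -> R), (forall i, 0 <= t i) ->
  forall f : 'rV[R]_n -> R,
    continuous f -> (exists M : R, forall x, `|f x| <= M) ->
    \int[P]_w f (\row_i X a (t i) w) @[a --> +oo] -->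
    \int[Q]_w f (\row_i Y (t i) w).

Definition nontrivial_process (R : realType) d (T : measurableType d)
    (P : probability T R) (Y : R -> T -> R) : Prop :=
  exists2 t : R, 0 <= t & ~ {ae P, forall w, Y t w = 0}.

(* The law of a process is determined by its finite-dimensional marginals. *)
Definition symmetric_process (R : realType) d (T : measurableType d)
    (P : probability T R) (Y : R -> T -> R) : Prop :=
  forall (n : nat) (t : 'I_n -> R), (forall i, 0 <= t i) ->
    same_law P (fun w => [tuple Y (t i) w | i < n])
             P (fun w => [tuple - Y (t i) w | i < n]).

(* X is locally self-similar of order H, with limit process Y. *)
Definition locally_self_similar (R : realType) d d' (T : measurableType d)
    (T' : measurableType d') (P : probability T R) (X : R -> {RV P >-> R})
    (H : R) (Q : probability T' R) (Y : R -> {RV Q >-> R}) : Prop :=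
  process_cvg_in_law P (fun a t w => a `^ H * X (t / a) w) Q Y /\
  nontrivial_process Q Y.

Definition LSS (R : realType) d d' (T : measurableType d)
    (T' : measurableType d') (P : probability T R) (X : R -> {RV P >-> R})
    (H : R) (Q : probability T' R) (Y : R -> {RV Q >-> R}) : Prop :=
  locally_self_similar X H Y /\ symmetric_process Q Y.

Definition SaS (R : realType) d (T : measurableType d) (P : probability T R)
    (alpha : R) (X : T -> R) : Prop :=
  0 < alpha <= 2 /\
  exists2 gamma : R, 0 < gamma &
    forall xi, charfun P X xi = (expR (- (gamma * `|xi| `^ alpha)))%:C.

Section entropy.
Context (R : realType) d (T : measurableType d) (P : probability T R).
Variable X : {RV P >-> R}.

Definition is_density (p : R -> R) : Prop :=
  [/\ measurable_fun setT (p : measurableTypeR R -> R),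
      forall x, 0 <= p x &
      forall A : set R, measurable A ->
        distribution P X A = (\int[@lebesgue_measure R]_(x in A) (p x)%:E)%E].

Definition absolutely_continuous : Prop := exists p, is_density p.

(* The density, unique up to a Lebesgue-null set when there is one; the zero
   function otherwise. *)
Definition density : R -> R := xget (fun=> 0) [set p | is_density p].

(* ln 0 = 0 in the library, so the convention 0 log 0 = 0 is built in. *)
Definition finite_entropy : Prop :=
  absolutely_continuous /\
  (@lebesgue_measure R).-integrable setT
    (fun x => (density x * ln (density x))%:E).

(* Meaningful only under finite_entropy. *)
Definition entropy : R :=
  - \int[@lebesgue_measure R]_x (density x * ln (density x)).

End entropy.

(* Main.v *)
Require Import Defs.
From HB Require Import structures.
From mathcomp Require Import all_boot all_order all_algebra.
From mathcomp Require Import all_classical all_reals all_analysis.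
From mathcomp Require Import measurable_realfun complex ring lra.
Import Order.TTheory GRing.Theory Num.Theory.
Import numFieldNormedType.Exports.
Local Open Scope classical_set_scope.
Local Open Scope ring_scope.
Set Implicit Arguments.
Unset Strict Implicit.
Unset Printing Implicit Defensive.

(* Write A = Re Psi. The convergence in law of a^H L_{t/a} forces A(a^H xi)/a
   to converge; the sector condition and the non-triviality of the limit give
   H > 0 and A(xi) ~ -g |xi|^(1/H) at infinity with g > 0, so that 1/H is the
   Blumenthal-Getoor index beta and, by symmetry, Y_1 is SaS with alpha = beta.
   For Z_t = t^(-1/beta) L_t one has h(L_t) = h(Z_t) + (1/beta) ln t, and it
   remains to see that h(Z_t) --> h(Y_1).
   For t <= 1 the characteristic functions of Z_t are bounded by K/(1 + xi^2):
   by Fourier inversion the densities exist, are uniformly bounded and converge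
   pointwise. The tails are controlled by the weight
     V(x) = int_0^oo e^(r u) (1 - cos (e^(-u) x)) du,
   which grows at least like a multiple of ln |x| and whose expectation
     E V(Z) = int_0^oo e^(r u) (1 - Re phi_Z(e^(-u))) du
   converges along Z_t, because 1 - Re phi(xi) <= K xi^(2r) near 0 by the moment
   condition on L_1. Since |p ln p| <= K' (1/(1 + x^2) + p (1 + V)), a dominated
   convergence theorem with varying dominating functions (Pratt) concludes. *)

(** * Densities and entropy *)

(** The obstacle is the tails: pointwise convergence of bounded densities says nothing about p ln p
    far out, and the only moment at hand may have a tiny order and concerns L_1 alone. The weight V
    is therefore chosen so that its expectation is read off from Re phi: with xi = e^(-u), V(x) is
    the integral over ]0, 1] of (1 - cos (xi x)) xi^(-1-r), the kernel of a fractional moment of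
    order r cut off at frequency 1. The number r is half of q = min(p, 1, beta). Of the bound
    xi^(2r), one half pays for the factor e^(r u) and the other leaves the integrable e^(-r u).
    Since q <= beta, the bound is uniform in t: for t <= 1, t |A(t^(-1/beta) xi)| is at most a
    multiple of t^(1 - q/beta) xi^q <= xi^q as long as the argument of A stays bounded. Fourier
    inversion goes through Abel summation: a factor e^(-e xi) turns the inversion integral into the
    law smoothed by a Cauchy kernel, and e --> 0 yields both nonnegativity and the identification of
    the density. The exponent is reached through |phi|^2 = e^(2 t A), whose logarithm is real, so
    that no branch has to be chosen; Im Psi is only ever estimated by the sector condition. *)

Section density.
Context (R : realType) d (T : measurableType d) (P : probability T R).
Local Notation lam := (@lebesgue_measure R).

Lemma density_integrable (X : {RV P >-> R}) p :
  is_density X p -> lam.-integrable setT (EFin \o p).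
Proof.
move=> [mp p0 pE]; apply/integrableP; split; first exact/measurable_EFinP.
under eq_integral do rewrite /= ger0_norm//.
by rewrite -pE// probability_setT ltry.
Qed.

Lemma density_unique (X : {RV P >-> R}) p q :
  is_density X p -> is_density X q -> ae_eq lam setT (EFin \o p) (EFin \o q).
Proof.
move=> dp dq; apply: integral_ae_eq => //.
- exact: density_integrable dp.
- by apply/measurable_EFinP; case: dq.
- by move=> E _ mE; case: dp => _ _ <-//; case: dq => _ _ <-.
Qed.

(** Change of variables holds for the Radon-Nikodym derivative of [nu]; [p] has the same integral
    over every measurable set, hence agrees with it almost everywhere. *)
Lemma ge0_integral_with_density (nu : {finite_measure set (measurableTypeR R) -> \bar R})
    (p : R -> R) (g : R -> \bar R) :
  measurable_fun setT (p : measurableTypeR R -> R) -> (forall x, 0 <= p x) ->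
  (forall A, measurable A -> nu A = (\int[lam]_(x in A) (p x)%:E)%E) ->
  measurable_fun setT (g : measurableTypeR R -> \bar R) ->
  (forall x, (0 <= g x)%E) ->
  (\int[nu]_x g x = \int[lam]_x (g x * (p x)%:E))%E.
Proof.
move=> mp p0 pE mg g0.
have dom : nu `<< lam.
  apply/null_content_dominatesP => A mA A0; rewrite pE//.
  by apply: null_set_integral => //; apply/measurable_funTS/measurable_EFinP.
rewrite -(Radon_Nikodym_SigmaFinite.change_of_variables dom)//.
have fi := Radon_Nikodym_SigmaFinite.f_integrable dom.
apply: ae_eq_integral => //.
- by apply: emeasurable_funM => //; exact: measurable_int fi.
- by apply: emeasurable_funM => //; exact/measurable_EFinP.
have : ae_eq lam setT (Radon_Nikodym_SigmaFinite.f nu lam) (EFin \o p).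
  apply: integral_ae_eq => //; first exact/measurable_EFinP.
  by move=> E _ mE; rewrite -Radon_Nikodym_SigmaFinite.f_integral// pE.
by apply: filterS => x /= + _ => ->.
Qed.

Lemma ge0_integral_density (X : {RV P >-> R}) p (g : R -> \bar R) :
  is_density X p -> measurable_fun setT (g : measurableTypeR R -> \bar R) ->
  (forall x, (0 <= g x)%E) ->
  (\int[P]_w g (X w) = \int[lam]_x (g x * (p x)%:E))%E.
Proof.
move=> [mp p0 pE] mg g0.
have mX : measurable_fun setT (X : T -> measurableTypeR R) := measurable_funP X.
(* [X] is repackaged with codomain [measurableTypeR R], the space that carries [lebesgue_measure],
   so that its law and Lebesgue measure live on the same type. *)
pose X' : {mfun T >-> measurableTypeR R} :=
  HB.pack (X : T -> measurableTypeR R) (isMeasurableFun.Build _ _ _ _ _ mX).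
rewrite -(@ge0_integral_with_density (distribution P X'))//.
by rewrite ge0_integral_distribution.
Qed.

Lemma density_density (X : {RV P >-> R}) p :
  is_density X p -> is_density X (density X).
Proof. by move=> dp; apply: (@xgetPex _ _ [set p | is_density X p]); exists p. Qed.

Lemma measurable_xlnx (p : R -> R) : measurable_fun setT (p : measurableTypeR R -> R) ->
  measurable_fun setT ((fun x => p x * ln (p x)) : measurableTypeR R -> R).
Proof. by move=> mp; apply: measurable_funM => //; exact: measurableT_comp. Qed.

Lemma entropy_ae (X : {RV P >-> R}) p : is_density X p ->
  ae_eq lam setT (fun x => (density X x * ln (density X x))%:E)
                 (fun x => (p x * ln (p x))%:E).
Proof.
move=> dp; have := density_unique (density_density dp) dp.
by apply: filterS => x /= /(_ I) [->].
Qed.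

Lemma finite_entropy_density (X : {RV P >-> R}) p : is_density X p ->
  lam.-integrable setT (fun x => (p x * ln (p x))%:E) -> finite_entropy X.
Proof.
move=> dp ip; split; first by exists p.
apply/integrableP; have mD := measurable_xlnx (p := density X).
have [mdX _ _] := density_density dp; split.
  by apply/measurable_EFinP; exact: measurable_xlnx.
case/integrableP : (ip) => mip; apply: le_lt_trans.
rewrite le_eqVlt; apply/orP; left; apply/eqP; apply: ae_eq_integral => //.
- by apply: measurableT_comp => //; apply/measurable_EFinP; exact: measurable_xlnx.
- exact: measurableT_comp.
- by have := entropy_ae dp; apply: filterS => x h _; rewrite (h I).
Qed.

Lemma entropy_density (X : {RV P >-> R}) p : is_density X p ->
  entropy X = - \int[lam]_x (p x * ln (p x)).
Proof.
move=> dp; rewrite /entropy /Rintegral; congr (- fine _).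
have [mdX _ _] := density_density dp; have [mp _ _] := dp.
apply: ae_eq_integral => //.
- by apply/measurable_EFinP; exact: measurable_xlnx.
- by apply/measurable_EFinP; exact: measurable_xlnx.
- exact: entropy_ae.
Qed.

End density.

(** * Convergence and Fubini for real-valued integrals *)

Lemma clip_dist (R : realType) (a b t : R) : `|t| <= a -> 0 <= b ->
  `|t - Num.max (- b) (Num.min t b)| <= a - Num.min a b.
Proof.
rewrite ler_norml => /andP[h1 h2] b0.
have -> : Num.min a b = if a <= b then a else b by case: leP.
have -> : Num.min t b = if t <= b then t else b by case: leP.
have [tb|tb] := leP t b.
  have -> : Num.max (- b) t = if - b <= t then t else - b by case: leP.
  by have [bt|bt] := leP (- b) t; have [ab|ab] := leP a b;
    rewrite ler_norml; apply/andP; split; lra.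
rewrite max_r; last lra.
by have [ab|ab] := leP a b; rewrite ler_norml; apply/andP; split; lra.
Qed.

Section limits.
Context d (U : measurableType d) (R : realType).
Variable mu : {measure set U -> \bar R}.

Lemma Rintegrable_le (D : set U) (f g : U -> R) : measurable D ->
  measurable_fun D f -> mu.-integrable D (EFin \o g) ->
  (forall x, D x -> `|f x| <= g x) -> mu.-integrable D (EFin \o f).
Proof.
move=> mD mf ig fg; apply: le_integrable ig => //; first exact/measurable_EFinP.
move=> x Dx /=; rewrite lee_fin; apply: le_trans (fg _ Dx) _; exact: ler_norm.
Qed.

Lemma Rdominated_cvg (D : set U) (f_ : nat -> U -> R) (f g : U -> R) :
  measurable D -> (forall n, measurable_fun D (f_ n)) ->
  (forall x, D x -> f_ n x @[n --> \oo] --> f x) ->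
  mu.-integrable D (EFin \o g) ->
  (forall n x, D x -> `|f_ n x| <= g x) ->
  mu.-integrable D (EFin \o f) /\
  \int[mu]_(x in D) f_ n x @[n --> \oo] --> \int[mu]_(x in D) f x.
Proof.
move=> mD mf ff ig fg.
have mf' n : measurable_fun D (EFin \o f_ n) by exact/measurable_EFinP.
have mlim : measurable_fun D f by exact: measurable_fun_cvg ff.
have [] := @dominated_convergence _ _ _ mu D mD (fun n => EFin \o f_ n)
    (EFin \o f) (EFin \o g) mf' _ _ ig.
- exact/measurable_EFinP.
- by apply: aeW => x Dx; apply: cvg_EFin; [exact: nearW|exact: ff].
- by apply: aeW => x n Dx; rewrite /= lee_fin fg.
move=> fi _ c; split => //; apply: fine_cvg.
by rewrite fineK//; exact: integrable_fin_num.
Qed.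

Lemma RintegrableD (D : set U) (f g : U -> R) : measurable D ->
  mu.-integrable D (EFin \o f) -> mu.-integrable D (EFin \o g) ->
  mu.-integrable D (EFin \o (fun x => f x + g x)).
Proof.
move=> mD fi gi; apply: eq_integrable (integrableD mD fi gi) => //.
Qed.

Lemma RintegrableB (D : set U) (f g : U -> R) : measurable D ->
  mu.-integrable D (EFin \o f) -> mu.-integrable D (EFin \o g) ->
  mu.-integrable D (EFin \o (fun x => f x - g x)).
Proof.
move=> mD fi gi; apply: eq_integrable (integrableB mD fi gi) => //.
Qed.

Lemma RintegrableZl (D : set U) (k : R) (f : U -> R) : measurable D ->
  mu.-integrable D (EFin \o f) ->
  mu.-integrable D (EFin \o (fun x => k * f x)).
Proof.
move=> mD fi; apply: eq_integrable (integrableZl mD k fi) => //.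
Qed.

(* Clip f_n to [-G, G]: dominated convergence applies to the clipped functions
   and the error is at most G_n - min G_n G, whose integral tends to 0. *)
Lemma pratt (f_ G_ : nat -> U -> R) (f G : U -> R) :
  (forall n, measurable_fun setT (f_ n)) ->
  (forall x, f_ n x @[n --> \oo] --> f x) ->
  (forall x, G_ n x @[n --> \oo] --> G x) ->
  (forall n x, `|f_ n x| <= G_ n x) ->
  (forall n, mu.-integrable setT (EFin \o G_ n)) ->
  mu.-integrable setT (EFin \o G) ->
  \int[mu]_x G_ n x @[n --> \oo] --> \int[mu]_x G x ->
  \int[mu]_x f_ n x @[n --> \oo] --> \int[mu]_x f x.
Proof.
move=> mf ff GG fG iG_ iG cG.
have mG_ n : measurable_fun setT (G_ n).
  by apply/measurable_EFinP; exact: measurable_int (iG_ n).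
have mG : measurable_fun setT G.
  by apply/measurable_EFinP; exact: measurable_int iG.
have G_0 n x : 0 <= G_ n x by exact: le_trans (fG n x).
have G0 x : 0 <= G x.
  by apply: (cvgr_to_ge (GG x)); apply: nearW => n.
have fleG x : `|f x| <= G x.
  have h : G_ n x - `|f_ n x| @[n --> \oo] --> G x - `|f x|.
    by apply: cvgB; [exact: GG|apply: cvg_norm; exact: ff].
  by rewrite -subr_ge0; apply: (cvgr_to_ge h); apply: nearW => n; rewrite subr_ge0.
pose h_ n x := Num.min (G_ n x) (G x).
pose c_ n x := Num.max (- G x) (Num.min (f_ n x) (G x)).
have mh n : measurable_fun setT (h_ n) by exact: measurable_minr.
have mc n : measurable_fun setT (c_ n).
  apply: measurable_maxr; first exact: measurableT_comp.
  exact: measurable_minr.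
have hG n x : `|h_ n x| <= G x.
  by rewrite ger0_norm /h_ ?le_min ?G_0 ?G0// ge_min lexx orbT.
have cG' n x : `|c_ n x| <= G x.
  by rewrite /c_ ler_norml le_max lexx/= ge_max ge_min lexx orbT andbT ge0_cp// oppr_le0.
have ch_ x : h_ n x @[n --> \oo] --> G x.
  rewrite /h_ -[X in _ --> X](minxx (G x)); under eq_fun do rewrite minr_absE.
  rewrite minr_absE; apply: cvgMr_tmp; apply: cvgB; last apply: cvg_norm.
    by apply: cvgD => //; exact: cvg_cst.
  by apply: cvgB => //; exact: cvg_cst.
have cc_ x : c_ n x @[n --> \oo] --> f x.
  have -> : f x = Num.max (- G x) (Num.min (f x) (G x)).
    have := fleG x; rewrite ler_norml => /andP[a b].
    by rewrite (min_l b) (max_r a).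
  rewrite /c_; under eq_fun do rewrite maxr_absE minr_absE.
  rewrite maxr_absE minr_absE.
  have m : (f_ n x + G x - `|f_ n x - G x|) / 2 @[n --> \oo] -->
           (f x + G x - `|f x - G x|) / 2.
    apply: cvgMr_tmp; apply: cvgB; last apply: cvg_norm.
      by apply: cvgD => //; exact: cvg_cst.
    by apply: cvgB => //; exact: cvg_cst.
  apply: cvgMr_tmp; apply: cvgD; last apply: cvg_norm.
    by apply: cvgD => //; exact: cvg_cst.
  by apply: cvgB => //; exact: cvg_cst.
have [_ ch] := @Rdominated_cvg setT h_ G G measurableT mh (fun x _ => ch_ x) iG (fun n x _ => hG n x).
have [_ cc] := @Rdominated_cvg setT c_ f G measurableT mc (fun x _ => cc_ x) iG (fun n x _ => cG' n x).
have ih n : mu.-integrable setT (EFin \o h_ n) by exact: (Rintegrable_le _ _ iG).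
have ic n : mu.-integrable setT (EFin \o c_ n) by exact: (Rintegrable_le _ _ iG).
have if_ n : mu.-integrable setT (EFin \o f_ n) by exact: (Rintegrable_le _ _ (iG_ n)).
have key : \int[mu]_x f_ n x - \int[mu]_x c_ n x @[n --> \oo] --> (0 : R).
  apply/norm_cvg0P.
  have lim0 : \int[mu]_x G_ n x - \int[mu]_x h_ n x @[n --> \oo] --> (0 : R).
    by rewrite -(subrr (\int[mu]_x G x)); exact: cvgB.
  apply: (squeeze_cvgr _ (cvg_cst 0) lim0); apply: nearW => n.
  rewrite normr_ge0/= -RintegralB// -RintegralB//.
  apply: le_trans (le_normr_Rintegral _ _) _ => //; first exact: RintegrableB.
  apply: le_Rintegral => //.
  - by apply: integrable_norm => //; exact: RintegrableB.
  - exact: RintegrableB.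
  move=> x _; rewrite /c_ /h_.
  exact: clip_dist.
have -> : (fun n => \int[mu]_x f_ n x) =
    (fun n => (\int[mu]_x f_ n x - \int[mu]_x c_ n x) + \int[mu]_x c_ n x).
  by apply/funext => n; rewrite subrK.
by rewrite -[X in _ --> X]add0r; exact: cvgD.
Qed.

End limits.

Section fubini.
Context d1 d2 (U : measurableType d1) (T : measurableType d2) (R : realType).
Variables (mu : {sigma_finite_measure set U -> \bar R}) (P : probability T R).

(** As [P] is a probability, a bound g u that does not depend on w makes the integrand integrable
    for the product measure. The indicator of [D] moves the domain into the integrand, so that
    Fubini on the whole product applies. *)
Lemma Rfubini (D : set U) (f : U -> T -> R) (g : U -> R) :
  measurable D ->
  measurable_fun setT (fun z : U * T => f z.1 z.2) ->
  mu.-integrable D (EFin \o g) ->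
  (forall u w, D u -> `|f u w| <= g u) ->
  [/\ mu.-integrable D (EFin \o (fun u => \int[P]_w f u w)),
      P.-integrable setT (EFin \o (fun w => \int[mu]_(u in D) f u w)) &
      \int[mu]_(u in D) (\int[P]_w f u w) =
      \int[P]_w (\int[mu]_(u in D) f u w)].
Proof.
move=> mD mf ig fg.
pose F (z : U * T) := (f z.1 z.2 * \1_D z.1)%:E.
have mF : measurable_fun setT F.
  apply/measurable_EFinP; apply: measurable_funM => //.
  have m1 : measurable_fun setT (\1_D : U -> R) by exact: measurable_indic.
  exact: (measurableT_comp m1 measurable_fst).
have mfu u : measurable_fun setT (f u).
  exact: (measurableT_comp mf (measurable_pair1 u)).
have mfw w : measurable_fun setT (fun u => f u w).
  exact: (measurableT_comp mf (measurable_pair2 w)).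
have ifu u : D u -> P.-integrable setT (EFin \o f u).
  move=> Du; apply: (@Rintegrable_le _ _ _ _ _ _ (fun=> g u)) => //.
    exact: finite_measure_integrable_cst.
  by move=> x _; exact: fg.
have ifw w : mu.-integrable D (EFin \o (fun u => f u w)).
  apply: (Rintegrable_le mD _ ig) => //; first exact: measurable_funTS.
  by move=> u Du; exact: fg.
have FE u : D u -> (\int[P]_w F (u, w) = (\int[P]_w f u w)%:E)%E.
  move=> Du; rewrite /F/= /Rintegral fineK; last exact: integrable_fin_num (ifu u Du).
  by apply: eq_integral => w _; rewrite indicE mem_set// mulr1.
have FE0 u : ~ D u -> (\int[P]_w F (u, w) = 0)%E.
  move=> Du; rewrite /F/=; apply: integral0_eq => w _.
  by rewrite indicE memNset// mulr0.
have FEw w : (\int[mu]_u F (u, w) = (\int[mu]_(u in D) f u w)%:E)%E.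
  rewrite /F/= /Rintegral fineK; last exact: integrable_fin_num (ifw w).
  rewrite [RHS]integral_mkcond; apply: eq_integral => u _.
  by rewrite patchE indicE; case: ifPn; rewrite ?mulr1 ?mulr0.
have iF : (mu \x P)%E.-integrable setT F.
  apply/integrable12ltyP => //.
  have [mg ltg] := integrableP _ _ _ ig.
  apply: le_lt_trans ltg; rewrite [leRHS]integral_mkcond.
  apply: ge0_le_integral => //.
  - by move=> u _; exact: integral_ge0.
  - apply: (measurable_fun_fubini_tonelli_F (fun z => `|F z|%E)) => //.
    exact: measurableT_comp.
  - by apply/(measurable_restrictT _ _).1 => //; exact: measurableT_comp.
  - move=> u _; rewrite patchE; case: ifPn => [/set_mem Du|/negP Du].
      apply: (@le_trans _ _ (\int[P]_w (cst `|g u|%:E w))%E).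
        apply: ge0_le_integral => //.
        + apply: measurableT_comp => //.
          by apply: (measurableT_comp mF (measurable_pair1 u)).
        + move=> w _; rewrite /F/= lee_fin indicE mem_set// mulr1.
          exact: le_trans (fg _ _ Du) (ler_norm _).
      by rewrite integral_cst//= probability_setT mule1.
    rewrite integral0_eq// => w _; rewrite /F/= indicE memNset ?mulr0 ?normr0//.
    by move=> Du'; apply: Du; exact: mem_set.
have h1 := integrable_fubini_F iF.
have h2 : P.-integrable setT (EFin \o (fun w => \int[mu]_(u in D) f u w)).
  apply: (@Rintegrable_le _ _ _ _ _ _ (fun=> \int[mu]_(u in D) g u)) => //.
  - apply/measurable_EFinP.
    by apply: eq_measurable_fun (measurable_fubini_G iF) => w _; rewrite /= -FEw.
  - exact: finite_measure_integrable_cst.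
  - move=> w _; apply: le_trans (le_normr_Rintegral mD (ifw w)) _.
    apply: le_Rintegral => //; first exact: integrable_norm (ifw w).
    by move=> u Du; exact: fg.
have h3 := Fubini iF.
split.
- apply: eq_integrable (integrableS measurableT mD (@subsetT _ _) h1) => //.
  by move=> u /set_mem Du; rewrite /= -FE.
- exact: h2.
- rewrite /Rintegral; congr fine.
  rewrite integral_mkcond [RHS](eq_integral (fun w => \int[mu]_u F (u, w))%E); last first.
    by move=> w _; rewrite FEw.
  rewrite -h3; apply: eq_integral => u _; rewrite patchE.
  by case: ifPn => [/set_mem/FE ->//|/negP Du]; rewrite FE0// => /mem_set.
Qed.

End fubini.

(** * Integrals of elementary functions *)

Section calculus.
Context (R : realType).
Local Notation lam := (@lebesgue_measure R).

Lemma is_derive_continuous (F f : R -> R) :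
  (forall x : R, is_derive x 1 F (f x)) -> continuous F.
Proof.
move=> dF x; apply: differentiable_continuous.
by apply/derivable1_diffP; case: (dF x).
Qed.

Lemma continuous_measurable (f : R -> R) (D : set R) : measurable D ->
  continuous f -> measurable_fun D (f : measurableTypeR R -> R).
Proof. by move=> mD cf; apply: measurable_funTS; exact: continuous_measurable_fun. Qed.

Lemma Rintegral_FTC (F f : R -> R) (a b : R) : a <= b -> continuous f ->
  (forall x : R, is_derive x 1 F (f x)) ->
  \int[lam]_(x in `[a, b]) f x = F b - F a.
Proof.
move=> ab cf dF; have cF := is_derive_continuous dF.
move: ab; rewrite le_eqVlt => /predU1P[<-|ab].
  by rewrite set_itv1 Rintegral_set1 subrr.
rewrite /Rintegral (@continuous_FTC2 _ f F)//.
- exact: continuous_subspaceT.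
- split.
  + by move=> x _; case: (dF x).
  + by apply: cvg_at_right_filter; exact: cF.
  + by apply: cvg_at_left_filter; exact: cF.
- by move=> x _; rewrite derive1E; exact: derive_val.
Qed.

Lemma Rintegral_FTCy (F f : R -> R) (a l : R) : (forall x, 0 <= f x) ->
  continuous f -> (forall x : R, is_derive x 1 F (f x)) ->
  F x @[x --> +oo] --> l ->
  lam.-integrable `[a, +oo[ (EFin \o f) /\
  \int[lam]_(x in `[a, +oo[) f x = l - F a.
Proof.
move=> f0 cf dF Fl; have cF := is_derive_continuous dF.
have E : (\int[lam]_(x in `[a, +oo[) (f x)%:E = l%:E - (F a)%:E)%E.
  apply: ge0_continuous_FTC2y => //.
  - exact: continuous_subspaceT.
  - by apply: cvg_at_right_filter; exact: cF.
  - by move=> x _; rewrite derive1E; exact: derive_val.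
split; last by rewrite /Rintegral E.
apply/integrableP; split.
  by apply/measurable_EFinP/measurable_funTS; exact: continuous_measurable_fun.
under eq_integral do rewrite /= ger0_norm//.
by rewrite E -EFinB ltry.
Qed.

Lemma cvgy_expRN (e : R) : 0 < e -> expR (- (e * x)) @[x --> +oo] --> (0 : R).
Proof.
move=> e0.
apply: (@cvg_comp _ _ _ (fun x => e * x) (fun x => expR (- x)) _ (pinfty_nbhs R)).
  by apply: gt0_cvgMry => //; exact: cvg_id.
exact: cvgr_expR.
Qed.

Lemma continuous_expRN (e : R) : continuous (fun x : R => expR (- (e * x))).
Proof.
move=> x; apply: (@continuous_comp _ _ _ (fun x : R => - (e * x)) expR).
  by apply: cvgN; apply: cvgMl_tmp; exact: cvg_id.
exact: continuous_expR.
Qed.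

Lemma integral_expRN (e : R) : 0 < e ->
  lam.-integrable `[0, +oo[ (EFin \o (fun x => expR (- (e * x)))) /\
  \int[lam]_(x in `[0, +oo[) expR (- (e * x)) = e^-1.
Proof.
move=> e0; have ne0 : e != 0 by rewrite gt_eqF.
have [||||ie ->] := @Rintegral_FTCy (fun x => - e^-1 * expR (- (e * x)))
  (fun x => expR (- (e * x))) 0 (- e^-1 * 0).
- by move=> x; exact: expR_ge0.
- exact: continuous_expRN.
- move=> x; apply: is_derive_eq.
  rewrite /GRing.scale/=; by field.
- by apply: cvgMl_tmp; exact: cvgy_expRN.
- by split => //; rewrite !mulr0 oppr0 expR0; ring.
Qed.

Lemma continuous_cosM (y : R) : continuous (fun x : R => cos (x * y)).
Proof.
move=> x; apply: (@continuous_comp _ _ _ (fun x : R => x * y) cos).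
  by apply: cvgMr_tmp; exact: cvg_id.
exact: continuous_cos.
Qed.

Lemma continuous_sinM (y : R) : continuous (fun x : R => sin (x * y)).
Proof.
move=> x; apply: (@continuous_comp _ _ _ (fun x : R => x * y) sin).
  by apply: cvgMr_tmp; exact: cvg_id.
exact: continuous_sin.
Qed.

(* One integrates e^{-e x} (1 + cos (x y)), which is nonnegative. *)
Lemma integral_expRN_cos (e y : R) : 0 < e ->
  \int[lam]_(x in `[0, +oo[) (expR (- (e * x)) * cos (x * y)) =
  e / (e ^+ 2 + y ^+ 2).
Proof.
move=> e0; have ne0 : e != 0 by rewrite gt_eqF.
have ne : e ^+ 2 + y ^+ 2 != 0.
  by rewrite gt_eqF// ltr_wpDr ?sqr_ge0// exprn_gt0.
have [ie1 e1] := integral_expRN e0.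
have icos : lam.-integrable `[0, +oo[ (EFin \o (fun x => expR (- (e * x)) * cos (x * y))).
  apply: (Rintegrable_le _ _ ie1) => //.
    apply: continuous_measurable => // x.
    by apply: cvgM; [exact: continuous_expRN|exact: continuous_cosM].
  move=> x _; rewrite normrM ger0_norm ?expR_ge0//.
  by rewrite ler_piMr ?expR_ge0// ler_norml cos_geN1 cos_le1.
pose F x := expR (- (e * x)) *
  ((e ^+ 2 + y ^+ 2)^-1 * (y * sin (x * y) - e * cos (x * y)) - e^-1).
have [||||_ E] := @Rintegral_FTCy F
  (fun x => expR (- (e * x)) * (1 + cos (x * y))) 0 0.
- by move=> x; rewrite mulr_ge0 ?expR_ge0// -lerBlDl sub0r cos_geN1.
- move=> x; apply: cvgM; first exact: continuous_expRN.
  by apply: cvgD; [exact: cvg_cst|exact: continuous_cosM].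
- move=> x; apply: is_derive_eq.
  rewrite /GRing.scale/=.
  rewrite !(mul0r, mulr0, addr0, add0r, mulr1, oppr0, subr0).
  by field; rewrite ne0 ne.
- apply/norm_cvg0P.
  pose K := (e ^+ 2 + y ^+ 2)^-1 * (`|y| + e) + e^-1.
  have c0 : expR (- (e * x)) * K @[x --> +oo] --> (0 : R).
    by rewrite -[X in _ --> X](mul0r K); apply: cvgMr_tmp; exact: cvgy_expRN.
  apply: (squeeze_cvgr _ (cvg_cst 0) c0); apply: nearW => x.
  rewrite normr_ge0/= /F normrM ger0_norm ?expR_ge0//.
  rewrite ler_wpM2l ?expR_ge0//.
  apply: le_trans (ler_normB _ _) _; rewrite /K lerD//; last first.
    by rewrite ger0_norm// invr_ge0 ltW.
  rewrite normrM ger0_norm; last by rewrite invr_ge0 addr_ge0 ?sqr_ge0.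
  rewrite ler_wpM2l//; first by rewrite invr_ge0 addr_ge0 ?sqr_ge0.
  apply: le_trans (ler_normB _ _) _; rewrite !normrM (gtr0_norm e0).
  rewrite lerD//.
    by rewrite ler_piMr// ler_norml sin_geN1 sin_le1.
  by rewrite ler_piMr ?(ltW e0)// ler_norml cos_geN1 cos_le1.
have : \int[lam]_(x in `[0, +oo[) (expR (- (e * x)) * (1 + cos (x * y))) =
    e^-1 + \int[lam]_(x in `[0, +oo[) (expR (- (e * x)) * cos (x * y)).
  rewrite -e1 -RintegralD//.
  by apply: eq_Rintegral => x _; rewrite mulrDr mulr1.
rewrite E; set I := (X in _ = _ + X) => h.
have hI : I = 0 - F 0 - e^-1 by rewrite h addrC addKr.
rewrite -[LHS]/I hI.
rewrite /F !mulr0 !mul0r oppr0 expR0 sin0 cos0.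
by field; rewrite ne0 ne.
Qed.

Lemma integral_cauchy (e a b c : R) : 0 < e -> a <= b ->
  \int[lam]_(x in `[a, b]) (e / (e ^+ 2 + (c - x) ^+ 2)) =
  atan ((b - c) / e) - atan ((a - c) / e).
Proof.
move=> e0 ab; have ne0 : e != 0 by rewrite gt_eqF.
have ne x : e ^+ 2 + x ^+ 2 != 0.
  by rewrite gt_eqF// ltr_wpDr ?sqr_ge0// exprn_gt0.
apply: (@Rintegral_FTC (fun x => atan ((x - c) / e))) => //.
  move=> x; apply: cvgMl_tmp; apply: cvgV => //.
  apply: cvgD; first exact: cvg_cst.
  rewrite expr2; under eq_fun do rewrite expr2.
  by apply: cvgM; apply: cvgB; [exact: cvg_cst|exact: cvg_id|exact: cvg_cst|exact: cvg_id].
move=> x; apply: is_derive_eq.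
rewrite /GRing.scale/=.
rewrite !(mul0r, mulr0, addr0, add0r, mulr1, oppr0, subr0).
rewrite -(sqrrN (c - x)) opprB; move: (x - c) (ne (x - c)) => u h.
have h1 : 1 + (u / e) ^+ 2 != 0 by rewrite gt_eqF// ltr_wpDr ?sqr_ge0.
by field; rewrite ne0 h.
Qed.

(** The limit is a sign and not an indicator: at y = 0 the arctangent vanishes for every n. This is
    why the endpoints of an interval count for one half in [integral_fdens]. *)
Lemma cvg_atan_sg (y : R) : atan (y / (n.+1%:R^-1)) @[n --> \oo] --> pi / 2 * Num.sg y.
Proof.
have cy : (n.+1%:R : R) @[n --> \oo] --> +oo.
  by have := @cvgr_idn R; rewrite -cvg_shiftS.
have cpos (z : R) : 0 < z -> atan (z / (n.+1%:R^-1)) @[n --> \oo] --> pi / 2.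
  move=> z0; under eq_fun do rewrite invrK.
  apply: (@cvg_comp _ _ _ (fun n : nat => n.+1%:R) (fun x => atan (z * x)) _
    (pinfty_nbhs R)) => //.
  apply: (@cvg_comp _ _ _ (fun x => z * x) atan _ (pinfty_nbhs R)).
    by apply: gt0_cvgMry => //; exact: cvg_id.
  exact: cvgy_atan.
have [y0|y0|->] := ltgtP y 0; last first.
- by rewrite sgr0 mulr0; under eq_fun do rewrite mul0r atan0; exact: cvg_cst.
- by rewrite gtr0_sg// mulr1; exact: cpos.
- rewrite ltr0_sg// mulrN1.
  have -> : (fun n => atan (y / n.+1%:R^-1)) = (fun n => - atan (- y / n.+1%:R^-1)).
    by apply/funext => n; rewrite mulNr atanN opprK.
  by apply: cvgN; apply: cpos; rewrite oppr_gt0.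
Qed.

Lemma integrable_oneDsqrV : lam.-integrable `[0, +oo[ (EFin \o (fun x => (1 + x ^+ 2)^-1)).
Proof.
have [|||] := @Rintegral_FTCy atan (fun x : R => (1 + x ^+ 2)^-1) 0 (pi / 2).
- by move=> x; rewrite invr_ge0 addr_ge0 ?sqr_ge0.
- exact: continuous_oneDsqrV.
- exact: cvgy_atan.
- by [].
Qed.

Lemma integrable_oneDsqrVT : lam.-integrable setT (EFin \o (fun x => (1 + x ^+ 2)^-1)).
Proof.
have mf : measurable_fun setT (EFin \o (fun x : R => (1 + x ^+ 2)^-1)).
  apply/measurable_EFinP; apply: continuous_measurable => //.
  exact: continuous_oneDsqrV.
apply/integrableP; split => //.
under eq_integral do rewrite /= ger0_norm ?invr_ge0 ?addr_ge0 ?sqr_ge0//.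
rewrite (@ge0_symfun_integralT R (fun x => (1 + x ^+ 2)^-1)).
- by rewrite -set_itvcy integral0y_oneDsqr -EFinM ltry.
- by move=> x; rewrite invr_ge0 addr_ge0 ?sqr_ge0.
- exact: continuous_oneDsqrV.
- by move=> x /=; rewrite sqrrN.
Qed.

End calculus.

(** * Fourier inversion *)

Lemma continuous_Rintegral d (U : measurableType d) (R : realType)
    (mu : {measure set U -> \bar R}) (D : set U) (f : R -> U -> R) (g : U -> R) :
  measurable D -> (forall x, measurable_fun D (f x)) ->
  (forall y, D y -> continuous (f ^~ y)) -> mu.-integrable D (EFin \o g) ->
  (forall x y, D y -> `|f x y| <= g y) ->
  continuous (fun x => \int[mu]_(y in D) f x y).
Proof.
move=> mD mf cf ig fg x; apply/(@cvg_nbhsP _ R^o) => u ux.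
apply: (proj2 (Rdominated_cvg mD (fun n => mf (u n)) _ ig (fun n => fg (u n)))).
move=> y Dy; apply: (cvg_comp u (f ^~ y) ux); exact: cf.
Qed.

Section inversion.
Context (R : realType) d (T : measurableType d) (P : probability T R).
Local Notation lam := (@lebesgue_measure R).

(** The real part and, below, the imaginary part of [charfun], kept apart so that every integral is
    real. *)
Definition Ecos (X : T -> R) (xi : R) := \int[P]_w cos (xi * X w).
Definition Esin (X : T -> R) (xi : R) := \int[P]_w sin (xi * X w).

Lemma integrable_bounded (f : T -> R) (M : R) : measurable_fun setT f ->
  (forall w, `|f w| <= M) -> P.-integrable setT (EFin \o f).
Proof.
move=> mf fM; apply: (@Rintegrable_le _ _ _ _ _ _ (fun=> M)) => //.
exact: finite_measure_integrable_cst.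
Qed.

Lemma norm_cos_le1 (x : R) : `|cos x| <= 1.
Proof. by rewrite ler_norml cos_geN1 cos_le1. Qed.

Lemma norm_sin_le1 (x : R) : `|sin x| <= 1.
Proof. by rewrite ler_norml sin_geN1 sin_le1. Qed.

Variable X : {RV P >-> R}.

Lemma measurable_cosX (xi c : R) : measurable_fun setT (fun w => cos (xi * (X w - c))).
Proof.
apply: (measurableT_comp (f := @cos R)).
  by apply: continuous_measurable => //; exact: continuous_cos.
by apply: measurable_funM => //; apply: measurable_funB.
Qed.

Lemma integrable_cosX (xi : R) : P.-integrable setT (EFin \o (fun w => cos (xi * X w))).
Proof.
apply: (@integrable_bounded _ 1) => [|w]; last exact: norm_cos_le1.
by have := measurable_cosX xi 0; under eq_fun do rewrite subr0.
Qed.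

Lemma measurable_sinX (xi : R) : measurable_fun setT (fun w => sin (xi * X w)).
Proof.
apply: (measurableT_comp (f := @sin R)).
  by apply: continuous_measurable => //; exact: continuous_sin.
by apply: measurable_funM.
Qed.

Lemma integrable_sinX (xi : R) : P.-integrable setT (EFin \o (fun w => sin (xi * X w))).
Proof.
apply: (@integrable_bounded _ 1) => [|w]; last exact: norm_sin_le1.
exact: measurable_sinX.
Qed.

Lemma continuous_Ecos : continuous (Ecos X).
Proof.
apply: (@continuous_Rintegral _ _ _ _ _ _ (fun=> 1)) => //.
- by move=> x; apply/measurable_EFinP; exact: measurable_int (integrable_cosX x).
- by move=> y _ x; exact: continuous_cosM.
- exact: finite_measure_integrable_cst.
- by move=> x y _; exact: norm_cos_le1.
Qed.

Lemma continuous_Esin : continuous (Esin X).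
Proof.
apply: (@continuous_Rintegral _ _ _ _ _ _ (fun=> 1)) => //.
- by move=> x; exact: measurable_sinX.
- by move=> y _ x; exact: continuous_sinM.
- exact: finite_measure_integrable_cst.
- by move=> x y _; exact: norm_sin_le1.
Qed.

Lemma RintegralP_cst (k : R) : \int[P]_w k = k.
Proof. by rewrite Rintegral_cst//= probability_setT mulr1. Qed.

Lemma norm_Ecos_le1 (xi : R) : `|Ecos X xi| <= 1.
Proof.
have ic := integrable_cosX xi.
apply: le_trans (le_normr_Rintegral _ ic) _ => //.
rewrite -[leRHS](RintegralP_cst 1); apply: le_Rintegral => //.
- exact: integrable_norm ic.
- exact: finite_measure_integrable_cst.
- by move=> w _; exact: norm_cos_le1.
Qed.

Lemma norm_Esin_le1 (xi : R) : `|Esin X xi| <= 1.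
Proof.
have ic := integrable_sinX xi.
apply: le_trans (le_normr_Rintegral _ ic) _ => //.
rewrite -[leRHS](RintegralP_cst 1); apply: le_Rintegral => //.
- exact: integrable_norm ic.
- exact: finite_measure_integrable_cst.
- by move=> w _; exact: norm_sin_le1.
Qed.

Lemma Ecos_le1 (xi : R) : Ecos X xi <= 1.
Proof. exact: le_trans (ler_norm _) (norm_Ecos_le1 xi). Qed.

(** The real part of e^(-i xi x) phi(xi). It is even in xi, so the inversion integral over the line,
    with its factor 1/(2 pi), becomes the integral over the half-line with factor 1/pi in
    [fdens]. *)
Definition trig (xi x : R) := Ecos X xi * cos (xi * x) + Esin X xi * sin (xi * x).

Lemma trigE (xi x : R) : trig xi x = \int[P]_w cos (xi * (X w - x)).
Proof.
rewrite /trig /Ecos /Esin -RintegralZr//; last exact: integrable_cosX.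
rewrite -RintegralZr//; last exact: integrable_sinX.
rewrite -RintegralD//.
- by apply: eq_Rintegral => w _; rewrite mulrBr cosB.
- apply: (@integrable_bounded _ `|cos (xi * x)|).
    apply: measurable_funM => //.
    by apply/measurable_EFinP; exact: measurable_int (integrable_cosX xi).
  by move=> w; rewrite normrM ler_piMl ?norm_cos_le1.
- apply: (@integrable_bounded _ `|sin (xi * x)|).
    by apply: measurable_funM => //; exact: measurable_sinX.
  by move=> w; rewrite normrM ler_piMl ?norm_sin_le1.
Qed.

Lemma measurable_trig (x : R) :
  measurable_fun setT ((fun xi => trig xi x) : measurableTypeR R -> R).
Proof.
apply: continuous_measurable => // xi; apply: cvgD; apply: cvgM.
- exact: continuous_Ecos.
- exact: continuous_cosM.
- exact: continuous_Esin.
- exact: continuous_sinM.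
Qed.

(** The exponential factor makes Fubini available without any decay of phi, and the inner integral
    in xi is a Cauchy kernel. Up to the factor pi, the right-hand side is the density at x of X plus
    an independent Cauchy variable of scale e. *)
Lemma abel_trig (e x : R) : 0 < e ->
  \int[lam]_(xi in `[0, +oo[) (expR (- (e * xi)) * trig xi x) =
  \int[P]_w (e / (e ^+ 2 + (X w - x) ^+ 2)).
Proof.
move=> e0; have [ie _] := integral_expRN e0.
under eq_Rintegral do rewrite trigE.
have [] := @Rfubini _ _ _ _ R lam P `[0, +oo[
  (fun xi w => expR (- (e * xi)) * cos (xi * (X w - x))) _ _ _ ie.
- by [].
- apply: measurable_funM.
    apply: (measurableT_comp (f := fun xi => expR (- (e * xi)))) => //.
    by apply: continuous_measurable => //; exact: continuous_expRN.
  apply: (measurableT_comp (f := @cos R)).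
    by apply: continuous_measurable => //; exact: continuous_cos.
  apply: measurable_funM => //; apply: measurable_funB => //.
  exact: (measurableT_comp (f := X)).
- by move=> u w _; rewrite normrM ger0_norm ?expR_ge0// ler_piMr ?expR_ge0// norm_cos_le1.
move=> _ _ E; transitivity (\int[lam]_(u in `[0, +oo[)
     \int[P]_w (expR (- (e * u)) * cos (u * (X w - x)))).
  apply: eq_Rintegral => u _; rewrite RintegralZl//.
  by apply: (@integrable_bounded _ 1) => [|w]; [exact: measurable_cosX|exact: norm_cos_le1].
by rewrite E; apply: eq_Rintegral => w _; rewrite integral_expRN_cos.
Qed.

Variable K : R.
Hypothesis decay : forall xi, 0 <= xi ->
  `|Ecos X xi| <= K / (1 + xi ^+ 2) /\ `|Esin X xi| <= K / (1 + xi ^+ 2).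

Lemma trig_le (xi x : R) : 0 <= xi -> `|trig xi x| <= 2 * K * (1 + xi ^+ 2)^-1.
Proof.
move=> xi0; have [hc hs] := decay xi0.
apply: le_trans (ler_normD _ _) _; rewrite !normrM.
have h1 : `|Ecos X xi| * `|cos (xi * x)| <= `|Ecos X xi| by rewrite ler_piMr ?norm_cos_le1.
have h2 : `|Esin X xi| * `|sin (xi * x)| <= `|Esin X xi| by rewrite ler_piMr ?norm_sin_le1.
lra.
Qed.

Lemma integrable_decay : lam.-integrable `[0, +oo[
  (EFin \o (fun xi => 2 * K * (1 + xi ^+ 2)^-1)).
Proof. by apply: RintegrableZl => //; exact: integrable_oneDsqrV. Qed.

Definition fdens (x : R) := pi^-1 * \int[lam]_(xi in `[0, +oo[) trig xi x.

Lemma fdens_continuous : continuous fdens.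
Proof.
suff h : continuous (fun x => \int[lam]_(xi in `[0, +oo[) trig xi x).
  by move=> x; apply: cvgMl_tmp; exact: h.
apply: (@continuous_Rintegral _ _ _ lam _ (fun x xi => trig xi x)
  (fun xi => 2 * K * (1 + xi ^+ 2)^-1)) => //.
- by move=> y; apply: measurable_funTS; exact: measurable_trig.
- move=> xi _ y; apply: cvgD; apply: cvgMl_tmp.
    by rewrite mulrC; under eq_fun do rewrite mulrC; exact: continuous_cosM.
  by rewrite mulrC; under eq_fun do rewrite mulrC; exact: continuous_sinM.
- exact: integrable_decay.
- by move=> y xi /=; rewrite in_itv/= andbT => xi0; exact: trig_le.
Qed.

(** Abel summation with e = 1/(n+1). It exhibits [fdens] as a limit of Cauchy smoothings of the law;
    nonnegativity, invisible in the definition, is immediate from this form. *)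
Lemma fdens_abel (x : R) :
  pi^-1 * \int[P]_w (n.+1%:R^-1 / (n.+1%:R^-1 ^+ 2 + (X w - x) ^+ 2)) @[n --> \oo]
  --> fdens x.
Proof.
apply: cvgMl_tmp.
have -> : (fun n => \int[P]_w (n.+1%:R^-1 / (n.+1%:R^-1 ^+ 2 + (X w - x) ^+ 2))) =
    (fun n => \int[lam]_(xi in `[0, +oo[) (expR (- (n.+1%:R^-1 * xi)) * trig xi x)).
  by apply/funext => n; rewrite abel_trig// invr_gt0.
apply: (proj2 (Rdominated_cvg _ _ _ integrable_decay _)) => //.
- move=> n; apply: measurable_funTS; apply: measurable_funM.
    by apply: continuous_measurable => //; exact: continuous_expRN.
  exact: measurable_trig.
- move=> xi _; rewrite -[X in _ --> X]mul1r; apply: cvgMr_tmp.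
  have c : expR (- (n.+1%:R^-1 * xi)) @[n --> \oo] --> expR (- (0 * xi)).
    apply: continuous_cvg; first exact: continuous_expR.
    by apply: cvgN; apply: cvgMr_tmp; exact: cvg_harmonic.
  by move: c; rewrite mul0r oppr0 expR0.
- move=> n xi /=; rewrite in_itv/= andbT => xi0.
  rewrite normrM ger0_norm ?expR_ge0//; apply: le_trans (trig_le x xi0).
  by rewrite ler_piMl// -[leRHS]expR0 ler_expR oppr_le0 mulr_ge0// invr_ge0.
Qed.

Lemma fdens_ge0 (x : R) : 0 <= fdens x.
Proof.
apply: (cvgr_to_ge (fdens_abel (x := x))); apply: nearW => n.
rewrite mulr_ge0 ?invr_ge0 ?pi_ge0//; apply: Rintegral_ge0 => w _.
by rewrite divr_ge0 ?invr_ge0// addr_ge0 ?sqr_ge0.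
Qed.

End inversion.

(** * Recognizing a density on half-open intervals *)

Section density_measure.
Context (R : realType) (p : R -> R).
Local Notation lam := (@lebesgue_measure R).
Hypothesis mp : measurable_fun setT (p : measurableTypeR R -> R).
Hypothesis p0 : forall x, 0 <= p x.

(** Made a measure so that it can be compared with the law of X by uniqueness on the pi-system of
    half-open intervals. *)
Definition density_measure (A : set (measurableTypeR R)) : \bar R :=
  (\int[lam]_(x in A) (p x)%:E)%E.

Let density_measure0 : density_measure set0 = 0%E.
Proof. by rewrite /density_measure integral_set0. Qed.

Let density_measure_ge0 A : (0 <= density_measure A)%E.
Proof. by apply: integral_ge0 => x _; rewrite lee_fin. Qed.

Let density_measure_sigma_additive : semi_sigma_additive density_measure.
Proof.
move=> /= A mA tA mUA; rewrite /density_measure ge0_integral_bigcup//=.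
- by apply: is_cvg_ereal_nneg_natsum_cond => n _ _; exact: density_measure_ge0.
- by apply/measurable_funTS/measurable_EFinP.
- by move=> x _; rewrite lee_fin.
Qed.

HB.instance Definition _ := isMeasure.Build _ _ _
  density_measure density_measure0 density_measure_ge0
  density_measure_sigma_additive.

Lemma is_density_itv d (T : measurableType d) (P : probability T R)
    (X : {RV P >-> R}) :
  (forall a b : R, a < b -> P (X @^-1` `]a, b]) = (\int[lam]_(x in `]a, b]) (p x)%:E)%E) ->
  is_density X p.
Proof.
move=> Xab; split => // A mA.
have mX : measurable_fun setT (X : T -> measurableTypeR R) := measurable_funP X.
pose X' : {mfun T >-> measurableTypeR R} :=
  HB.pack (X : T -> measurableTypeR R) (isMeasurableFun.Build _ _ _ _ _ mX).
pose g (k : nat) : set (measurableTypeR R) := `]- (k%:R : R), k%:R]%classic.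
suff : distribution P X' A = density_measure A by [].
apply: (@measure_unique _ R (measurableTypeR R) (@ocitv R) g _ _ _ _
  (distribution P X') density_measure) => //.
- exact: ocitvI.
- by move=> k; exact: is_ocitv.
- rewrite -subTset => x _; have [n xn] : exists n : nat, `|x| < n%:R.
    by exists (Num.truncn `|x|).+1; exact: truncnS_gt.
  exists n => //; rewrite /g /= in_itv/=.
  by move: xn; rewrite ltr_norml => /andP[-> /ltW].
- move=> _ [[a b] _ <-] /=; have [ba|ab] := leP b a.
    by rewrite set_itv_ge ?measure0// bnd_simp -leNgt.
  exact: Xab.
- by move=> k; rewrite -ge0_fin_numE//; apply: fin_num_measure; exact: measurable_itv.
Qed.

End density_measure.

Lemma atanB_le (R : realType) (x y : R) : `|atan x - atan y| <= pi.
Proof.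
have atb (z : R) : - (pi / 2) <= atan z <= pi / 2.
  by rewrite (ltW (atan_gtNpi2 _)) (ltW (atan_ltpi2 _)).
have := atb x; have := atb y.
by rewrite ler_norml => /andP[h1 h2] /andP[h3 h4]; apply/andP; split; lra.
Qed.

Lemma le_sg (R : realType) (x y : R) : x <= y -> Num.sg x <= Num.sg y.
Proof.
have [x0|x0|->] := ltgtP x 0; have [y0|y0|->] := ltgtP y 0; move=> xy;
  rewrite ?(ltr0_sg x0) ?(gtr0_sg x0) ?(ltr0_sg y0) ?(gtr0_sg y0) ?sgr0 //; lra.
Qed.

(** * The inverted function is the density *)

Section inversion.
Context (R : realType) d (T : measurableType d) (P : probability T R).
Variable X : {RV P >-> R}.
Local Notation lam := (@lebesgue_measure R).
Variable K : R.
Hypothesis decay : forall xi, 0 <= xi ->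
  `|Ecos P X xi| <= K / (1 + xi ^+ 2) /\ `|Esin P X xi| <= K / (1 + xi ^+ 2).

(** The bound is uniform in e, and the constant is exactly K because 2 K / (1 + xi^2) has integral
    pi K over the half-line. *)
Lemma abel_le (e x : R) : 0 < e ->
  `|pi^-1 * \int[P]_w (e / (e ^+ 2 + (X w - x) ^+ 2))| <= K.
Proof.
move=> e0.
rewrite -abel_trig// normrM gtr0_norm ?invr_gt0 ?pi_gt0//.
have iK := @integrable_decay R K.
have mf : measurable_fun (`[0, +oo[ : set R) ((fun xi => expR (- (e * xi)) * trig X xi x) : measurableTypeR R -> R).
  apply: measurable_funTS; apply: measurable_funM; last exact: measurable_trig.
  by apply: continuous_measurable => //; exact: continuous_expRN.
have le1 xi : `[0, +oo[%classic xi -> `|expR (- (e * xi)) * trig X xi x| <= 2 * K * (1 + xi ^+ 2)^-1.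
  move=> /=; rewrite in_itv/= andbT => xi0.
  rewrite normrM ger0_norm ?expR_ge0//; apply: le_trans (trig_le decay x xi0).
  by rewrite ler_piMl// -[leRHS]expR0 ler_expR oppr_le0 mulr_ge0// ltW.
have if_ : lam.-integrable `[0, +oo[ (EFin \o (fun xi => expR (- (e * xi)) * trig X xi x)).
  by apply: (Rintegrable_le _ _ iK) => //; exact: mf.
apply: (@le_trans _ _ (pi^-1 * \int[lam]_(xi in `[0, +oo[) (2 * K * (1 + xi ^+ 2)^-1))).
  rewrite ler_wpM2l ?invr_ge0 ?pi_ge0//.
  apply: le_trans (le_normr_Rintegral _ if_) _ => //.
  by apply: le_Rintegral => //; exact: integrable_norm if_.
rewrite RintegralZl//; last exact: integrable_oneDsqrV.
rewrite /Rintegral integral0y_oneDsqr/=.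
have p0 : pi != 0 :> R by rewrite gt_eqF// pi_gt0.
have -> : 2 * K * (pi / 2) = pi * K by field.
by rewrite mulKf.
Qed.

Lemma fdens_norm_le (x : R) : `|fdens X x| <= K.
Proof.
apply: (cvgr_to_le (cvg_norm (fdens_abel decay (x := x)))); apply: nearW => n.
by apply: abel_le; rewrite invr_gt0.
Qed.

Lemma integrable_itv (f : R -> R) (a b : R) : continuous f ->
  lam.-integrable `[a, b] (EFin \o f).
Proof.
move=> cf; apply: continuous_compact_integrable; first exact: segment_compact.
exact: continuous_subspaceT.
Qed.

Lemma integral_abel (e a b : R) : 0 < e -> a <= b ->
  lam.-integrable `[a, b]
    (EFin \o (fun x => \int[P]_w (e / (e ^+ 2 + (X w - x) ^+ 2)))) /\
  \int[lam]_(x in `[a, b]) (\int[P]_w (e / (e ^+ 2 + (X w - x) ^+ 2))) =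
  \int[P]_w (atan ((b - X w) / e) - atan ((a - X w) / e)).
Proof.
move=> e0 ab.
have ne u : 0 < e ^+ 2 + u ^+ 2 by rewrite ltr_wpDr ?sqr_ge0// exprn_gt0.
have [] := @Rfubini _ _ _ _ R lam P `[a, b]
  (fun x w => e / (e ^+ 2 + (X w - x) ^+ 2)) (fun=> e^-1).
- by [].
- apply: (@measurableT_comp _ _ _ _ _ _ (fun u : measurableTypeR R => e / (e ^+ 2 + u ^+ 2))
    _ (fun z : measurableTypeR R * T => X z.2 - z.1)).
    apply: continuous_measurable => // u; apply: cvgMl_tmp; apply: cvgV.
      by rewrite gt_eqF.
    apply: cvgD; first exact: cvg_cst.
    by rewrite expr2; under eq_fun do rewrite expr2; apply: cvgM; exact: cvg_id.
  apply: measurable_funB => //.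
  exact: (measurableT_comp (f := X)).
- by apply: integrable_itv => x; exact: cvg_cst.
- move=> x w _; rewrite ger0_norm; last by rewrite divr_ge0 ?ltW.
  rewrite ler_pdivrMr// mulrDr expr2 mulKf ?gt_eqF// lerDl.
  by rewrite mulr_ge0 ?sqr_ge0// invr_ge0 ltW.
move=> i1 _ E; split => //.
by rewrite E; apply: eq_Rintegral => w _; rewrite integral_cauchy.
Qed.

Lemma measurable_sgX (a : R) : measurable_fun setT (fun w => Num.sg (a - X w)).
Proof.
have -> : (fun w => Num.sg (a - X w)) =
    (fun w => \1_(X @^-1` `]-oo, a[) w - \1_(X @^-1` `]a, +oo[) w).
  apply/funext => w; rewrite !indicE.
  have [aw|aw|aw] := ltgtP (X w) a.
  - rewrite gtr0_sg ?subr_gt0// mem_set/= ?in_itv//= memNset ?subr0//= in_itv/= andbT.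
    by rewrite ltNge (ltW aw).
  - rewrite ltr0_sg ?subr_lt0// memNset/= ?in_itv/= ?mem_set ?sub0r//= ?in_itv/= ?andbT//.
    by rewrite ltNge (ltW aw).
  - by rewrite aw subrr sgr0 !memNset ?subr0//= in_itv/= aw ?ltxx.
apply: measurable_funB; apply: measurable_indic.
  by rewrite -[X in measurable X]setTI; exact: measurable_funP.
by rewrite -[X in measurable X]setTI; exact: measurable_funP.
Qed.

Lemma norm_sg_le1 (x : R) : `|Num.sg x| <= 1.
Proof. by rewrite normr_sg; case: (x == 0). Qed.

(** Levy's inversion formula. For a < b the integrand on the right is 1 on ]a, b[ and 1/2 at both
    endpoints. It is the limit of the arctangent differences obtained by integrating the Cauchy
    kernels over [a, b], and both sides pass to the limit by dominated convergence. *)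
Lemma integral_fdens (a b : R) : a <= b ->
  \int[lam]_(x in `[a, b]) fdens X x =
  \int[P]_w (2^-1 * (Num.sg (b - X w) - Num.sg (a - X w))).
Proof.
move=> ab.
pose k n x := \int[P]_w (n.+1%:R^-1 / (n.+1%:R^-1 ^+ 2 + (X w - x) ^+ 2)).
have e0 n : 0 < n.+1%:R^-1 :> R by rewrite invr_gt0.
have [ik kE] : (forall n, lam.-integrable `[a, b] (EFin \o k n)) /\
    (forall n, \int[lam]_(x in `[a, b]) k n x =
  \int[P]_w (atan ((b - X w) / n.+1%:R^-1) - atan ((a - X w) / n.+1%:R^-1))).
  by split => n; have [] := integral_abel (e0 n) ab.
have [_ c1] := @Rdominated_cvg _ _ _ lam `[a, b] (fun n x => pi^-1 * k n x)
  (fdens X) (fun=> K) (measurable_itv _)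
  (fun n => measurable_funM (measurable_cst _) (proj1 (measurable_EFinP _ _) (measurable_int _ (ik n))))
  (fun x _ => fdens_abel decay (x := x)) (integrable_itv a b (fun x => cvg_cst K))
  (fun n x _ => abel_le x (e0 n)).
have mat c n : measurable_fun setT (fun w => atan ((c - X w) / n.+1%:R^-1)).
  apply: (measurableT_comp (f := @atan R)).
    by apply: continuous_measurable => // x; exact: continuous_atan.
  by apply: measurable_funM => //; apply: measurable_funB.
have [|||||_ c2] := @Rdominated_cvg _ _ _ P setT
  (fun n w => pi^-1 * (atan ((b - X w) / n.+1%:R^-1) - atan ((a - X w) / n.+1%:R^-1)))
  (fun w => 2^-1 * (Num.sg (b - X w) - Num.sg (a - X w))) (fun=> 1).
- by [].
- by move=> n; apply: measurable_funM => //; apply: measurable_funB.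
- move=> w _.
  have p0 : pi != 0 :> R by rewrite gt_eqF// pi_gt0.
  have -> : 2^-1 * (Num.sg (b - X w) - Num.sg (a - X w)) =
      pi^-1 * (pi / 2 * Num.sg (b - X w) - pi / 2 * Num.sg (a - X w)).
    by rewrite -mulrBr !mulrA mulVf// mul1r.
  by apply: cvgMl_tmp; apply: cvgB; exact: cvg_atan_sg.
- exact: finite_measure_integrable_cst.
- move=> n w _; rewrite normrM gtr0_norm ?invr_gt0 ?pi_gt0//.
  by rewrite ler_pdivrMl ?pi_gt0// mulr1 atanB_le.
have E : (fun n => \int[lam]_(x in `[a, b]) (pi^-1 * k n x)) = (fun n => 
  \int[P]_w (pi^-1 * (atan ((b - X w) / n.+1%:R^-1) - atan ((a - X w) / n.+1%:R^-1)))).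
  apply/funext => n; rewrite RintegralZl// kE RintegralZl//.
  apply: (@integrable_bounded _ _ _ _ _ pi); first exact: measurable_funB.
  by move=> w; exact: atanB_le.
rewrite E in c1.
exact: (cvg_unique _ c1 c2).
Qed.

Lemma prob_Rintegral (A : set R) : measurable A ->
  \int[P]_w (\1_A (X w) : R) = fine (P (X @^-1` A)).
Proof.
move=> mA; rewrite /Rintegral; congr fine.
have mXA : measurable (X @^-1` A) by rewrite -[X in measurable X]setTI; exact: measurable_funP.
rewrite -(setIT (X @^-1` A)) -integral_indic//.
Qed.

(** By the inversion formula on [c - D, c + D] and the bound K on [fdens], an atom at c has mass at
    most 2 D K. *)
Lemma prob_point (c : R) : P (X @^-1` [set c]) = 0%E.
Proof.
have K0 : 0 <= K by exact: le_trans (fdens_norm_le 0).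
have mXc : measurable (X @^-1` [set c]) by rewrite -[X in measurable X]setTI; exact: measurable_funP.
rewrite -[LHS]fineK ?fin_num_measure//; congr EFin; apply/eqP.
rewrite eq_le fine_ge0// andbT; apply/ler_addgt0Pr => e e0; rewrite add0r.
(* With this D, 2 D K = e K / (K + 1) <= e; the denominator K + 1 also covers K = 0. *)
pose D := e / (2 * (K + 1)).
have D0 : 0 < D by rewrite divr_gt0// mulr_gt0// ltr_wpDl.
have cD : c - D <= c + D by lra.
rewrite -prob_Rintegral//.
apply: (@le_trans _ _ (\int[lam]_(x in `[c - D, c + D]) fdens X x)).
  rewrite integral_fdens//; apply: le_Rintegral => //.
  - apply: (@integrable_bounded _ _ _ _ _ 1).
      by apply: measurable_indic.
    by move=> w; rewrite indicE; case: (_ \in _); rewrite ?normr0 ?normr1.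
  - apply: (@integrable_bounded _ _ _ _ _ 1).
      apply: measurable_funM => //.
      by apply: measurable_funB; exact: measurable_sgX.
    move=> w; rewrite normrM gtr0_norm ?invr_gt0// ler_pdivrMl// mulr1.
    apply: le_trans (ler_normB _ _) _.
    by have := norm_sg_le1 (c + D - X w); have := norm_sg_le1 (c - D - X w); lra.
  - move=> w _; rewrite indicE; have [->|ne] := eqVneq (X w) c.
      rewrite mem_set// gtr0_sg; last lra.
      by rewrite ltr0_sg/=; lra.
    rewrite memNset; last by move=> /= /eqP; exact/negP.
    rewrite mulr_ge0 ?invr_ge0// subr_ge0; apply: le_sg; lra.
apply: (@le_trans _ _ (\int[lam]_(x in `[c - D, c + D]) K)).
  apply: le_Rintegral => //.
  - by apply: integrable_itv; exact: fdens_continuous decay.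
  - by apply: integrable_itv => x; exact: cvg_cst.
  - by move=> x _; apply: le_trans (ler_norm _) (fdens_norm_le x).
rewrite Rintegral_cst//= lebesgue_measure_itv/= lte_fin.
have -> : c - D < c + D by lra.
rewrite -EFinD/= (_ : c + D - (c - D) = 2 * D); last by ring.
rewrite /D; have K1 : K + 1 != 0 by rewrite gt_eqF// ltr_wpDl.
have -> : K * (2 * (e / (2 * (K + 1)))) = e * (K / (K + 1)) by field.
rewrite ler_piMr ?(ltW e0)// ler_pdivrMr ?ltr_wpDl//; lra.
Qed.

Lemma fdens_is_density : is_density X (fdens X).
Proof.
apply: is_density_itv.
- by apply: continuous_measurable => //; exact: fdens_continuous decay.
- exact: fdens_ge0 decay.
move=> a b ab.
have mXA : measurable (X @^-1` `]a, b]) by rewrite -[X in measurable X]setTI; exact: measurable_funP.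
have If : lam.-integrable `[a, b] (EFin \o fdens X).
  by apply: integrable_itv; exact: fdens_continuous decay.
have If' : lam.-integrable `]a, b] (EFin \o fdens X).
  apply: integrableS If => // x /=.
  by rewrite !in_itv/= => /andP[/ltW -> ->].
rewrite -[LHS]fineK ?fin_num_measure// -[RHS]fineK; last exact: integrable_fin_num If'.
congr EFin; rewrite -prob_Rintegral//.
rewrite -[RHS]/(\int[lam]_(x in `]a, b]) fdens X x) Rintegral_itv_obnd_cbnd//.
rewrite integral_fdens ?(ltW ab)//.
have mX c : measurable (X @^-1` [set c]) by rewrite -[X in measurable X]setTI; exact: measurable_funP.
rewrite /Rintegral; congr fine; apply: ae_eq_integral => //.
- by apply/measurable_EFinP; apply: measurable_indic.
- apply/measurable_EFinP; apply: measurable_funM => //.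
  by apply: measurable_funB; exact: measurable_sgX.
(* The integrand of the inversion formula and the indicator of ]a, b] differ only where X is a or b,
   which is a null event since the law has no atoms. *)
exists (X @^-1` [set a] `|` X @^-1` [set b]); split.
- exact: measurableU.
- by apply: null_set_setU => //; exact: prob_point.
- move=> w /= h; apply: contrapT => /not_orP[Xa Xb]; apply: h => _; congr EFin.
  rewrite indicE; have [aw|aw|//] := ltgtP (X w) a.
    rewrite memNset/= ?in_itv/=; last by rewrite ltNge (ltW aw).
    by rewrite !gtr0_sg ?subrr ?mulr0// subr_gt0// (lt_trans aw).
  have [bw|bw|//] := ltgtP (X w) b.
    rewrite mem_set/= ?in_itv/= ?aw ?(ltW bw)//.
    by rewrite gtr0_sg ?subr_gt0// ltr0_sg ?subr_lt0//; lra.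
  rewrite memNset/= ?in_itv/=; last by rewrite leNgt bw andbF.
  by rewrite !ltr0_sg ?subr_lt0// subrr mulr0.
Qed.

End inversion.

(** * The logarithmic weight *)

Section real_inequalities.
Context (R : realType).
Local Notation lam := (@lebesgue_measure R).
Implicit Types x y q s : R.

Lemma onem_cos_le (y : R) : 1 - cos y <= `|y|.
Proof.
rewrite -(cos_norm y); move: `|y| (normr_ge0 y) => {}y y0.
have dF (x : R) : is_derive x 1 (fun x => - cos x) (sin x).
  by apply: is_derive_eq; rewrite opprK.
have := Rintegral_FTC y0 (@continuous_sin R) dF.
rewrite cos0 opprK => E.
have -> : 1 - cos y = - cos y + 1 by rewrite addrC.
rewrite -E.
rewrite [leRHS](_ : y = \int[lam]_(x in `[0, y]) 1); last first.
  rewrite Rintegral_cst//= lebesgue_measure_itv/= lte_fin.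
  by move: y0; rewrite le_eqVlt => /predU1P[<-|->]; rewrite ?ltxx ?mulr0//= oppr0 addr0 mul1r.
apply: le_Rintegral => //.
- by apply: integrable_itv; exact: continuous_sin.
- by apply: integrable_itv => x; exact: cvg_cst.
Qed.

(** With s the square root of q, q ln q = 2 s^2 ln s, and - ln s = ln (1/s) <= 1/s. *)
Lemma xlnx_le_sqrt q : 0 <= q -> q <= 1 -> `|q * ln q| <= 2 * Num.sqrt q.
Proof.
rewrite le_eqVlt => /predU1P[<-|q0] q1; first by rewrite mul0r normr0 sqrtr0 mulr0.
set s := Num.sqrt q; have s0 : 0 < s by rewrite sqrtr_gt0.
have -> : q = s ^+ 2 by rewrite sqr_sqrtr// ltW.
rewrite lnXn// normrM ger0_norm ?sqr_ge0//.
have s1 : s <= 1 by rewrite -[1]sqrtr1 ler_wsqrtr.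
rewrite ler0_norm; last by rewrite mulrn_wle0// ln_le0.
have : - ln s <= s^-1 by rewrite -lnV ?posrE//; apply/ltW/ln_sublinear; rewrite invr_gt0.
move=> h; have sn : s != 0 by rewrite gt_eqF.
have -> : s ^+ 2 * - (ln s *+ 2) = 2 * (s * s * - ln s) by ring.
rewrite ler_pM2l//.
apply: le_trans (ler_wpM2l (mulr_ge0 (ltW s0) (ltW s0)) h) _.
by rewrite mulfK.
Qed.

(** Three regimes. If q >= 1, then ln q <= ln M. If y^(-2) <= q < 1, then - ln q <= 2 ln y. If q <
    y^(-2), the square-root bound gives 2 / y. It is used with y = 1 + x^2: the first term is then
    integrable, and ln y is controlled by the weight. *)
Lemma xlnx_bound M y q : 1 <= M -> 1 <= y -> 0 <= q -> q <= M ->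
  `|q * ln q| <= 2 * y^-1 + q * (ln M + 2 * ln y).
Proof.
move=> M1 y1 q0 qM; have y0 : 0 < y by exact: lt_le_trans y1.
have lM : 0 <= ln M by exact: ln_ge0.
have ly : 0 <= ln y by exact: ln_ge0.
have iy0 : 0 <= y^-1 by rewrite invr_ge0 ltW.
have [q1|q1] := leP 1 q.
  have qp : 0 < q by exact: lt_le_trans q1.
  rewrite ger0_norm ?mulr_ge0 ?ln_ge0//.
  have : q * ln q <= q * ln M by rewrite ler_wpM2l// ler_ln// posrE (lt_le_trans qp).
  have := mulr_ge0 q0 ly; lra.
have [qy|qy] := leP (y^-1 ^+ 2) q.
  have qp : 0 < q by apply: lt_le_trans qy; rewrite exprn_gt0// invr_gt0.
  rewrite normrM (ger0_norm q0) ler0_norm ?ln_le0 ?(ltW q1)//.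
  have : - ln q <= 2 * ln y.
    have : ln (y^-1 ^+ 2) <= ln q by rewrite ler_ln// posrE// exprn_gt0// invr_gt0.
    by rewrite lnXn ?invr_gt0// lnV ?posrE// => h; lra.
  move=> h; have := ler_wpM2l q0 h; have := mulr_ge0 q0 lM; lra.
apply: le_trans (xlnx_le_sqrt q0 (ltW q1)) _.
have : Num.sqrt q <= y^-1.
  by rewrite -(ger0_norm iy0) -sqrtr_sqr ler_wsqrtr// ltW.
have := mulr_ge0 q0 (addr_ge0 lM (mulr_ge0 (ler0n R 2) ly)).
lra.
Qed.

(** For q > 0 this is continuity of [ln]. At q = 0, where [ln] is not continuous, the square-root
    bound squeezes the sequence to 0. *)
Lemma cvg_xlnx (u : nat -> R) (q : R) : (forall n, 0 <= u n) ->
  u n @[n --> \oo] --> q -> u n * ln (u n) @[n --> \oo] --> q * ln q.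
Proof.
move=> u0 uq; have : 0 <= q by apply: (cvgr_to_ge uq); exact: nearW.
rewrite le_eqVlt => /predU1P[q0|q0]; last first.
  by apply: cvgM => //; apply: continuous_cvg => //; exact: continuous_ln.
rewrite -q0 mul0r; apply/norm_cvg0P.
have sq : 2 * Num.sqrt (u n) @[n --> \oo] --> (0 : R).
  have <- : 2 * Num.sqrt q = 0 by rewrite -q0 sqrtr0 mulr0.
  apply: cvgMl_tmp.
  by apply: continuous_cvg => //; exact: sqrt_continuous.
apply: (squeeze_cvgr _ (cvg_cst 0) sq).
have : \forall n \near \oo, u n < 1 by apply: (cvgr_lt _ uq); rewrite -q0.
apply: filterS => n un1; rewrite normr_ge0/=; apply: xlnx_le_sqrt => //; exact: ltW.
Qed.

End real_inequalities.

Section log_weight.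
Context (R : realType) (r : R).
Hypotheses (r0 : 0 < r) (r1 : r < 1).
Local Notation lam := (@lebesgue_measure R).

Definition weight_fun (u x : R) := expR (r * u) * (1 - cos (expR (- u) * x)).

Definition weight (x : R) := \int[lam]_(u in `[0, +oo[) weight_fun u x.

Lemma weight_fun_ge0 u x : 0 <= weight_fun u x.
Proof. by rewrite mulr_ge0 ?expR_ge0// subr_ge0 cos_le1. Qed.

Lemma continuous_weight_fun x : continuous (weight_fun ^~ x).
Proof.
move=> u; apply: cvgM.
  apply: (@continuous_comp _ _ _ (fun u : R => r * u) expR).
    by apply: cvgMl_tmp; exact: cvg_id.
  exact: continuous_expR.
apply: cvgB; first exact: cvg_cst.
apply: (@continuous_comp _ _ _ (fun u : R => expR (- u) * x) cos).
  apply: cvgMr_tmp.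
  apply: (@continuous_comp _ _ _ (fun u : R => - u) expR).
    by apply: cvgN; exact: cvg_id.
  exact: continuous_expR.
exact: continuous_cos.
Qed.

(** Since 1 - cos y <= |y|, the integrand is at most |x| e^(-(1-r) u); this is where r < 1 is
    used. *)
Lemma integrable_weight_fun x : lam.-integrable `[0, +oo[ (EFin \o (weight_fun ^~ x)).
Proof.
have r1' : 0 < 1 - r by rewrite subr_gt0.
have [ie _] := integral_expRN r1'.
apply: (Rintegrable_le _ _ (RintegrableZl (`|x|) _ ie)) => //.
  by apply: measurable_funTS; apply: continuous_measurable => //; exact: continuous_weight_fun.
move=> u _; rewrite ger0_norm ?weight_fun_ge0// /weight_fun.
have -> : `|x| * expR (- ((1 - r) * u)) = expR (r * u) * (expR (- u) * `|x|).
  by rewrite mulrA -expRD mulrC; congr (expR _ * _); ring.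
rewrite ler_wpM2l ?expR_ge0//; apply: le_trans (onem_cos_le _) _.
by rewrite normrM ger0_norm ?expR_ge0.
Qed.

Lemma weight_ge0 x : 0 <= weight x.
Proof. by apply: Rintegral_ge0 => u _; exact: weight_fun_ge0. Qed.

Lemma measurable_weight_fun2 d (T : measurableType d) (X : T -> R) :
  measurable_fun setT X ->
  measurable_fun setT (fun z : measurableTypeR R * T => weight_fun z.1 (X z.2)).
Proof.
move=> mX; apply: measurable_funM.
  apply: (@measurableT_comp _ _ _ _ _ _ (fun u : measurableTypeR R => expR (r * u))) => //.
  apply: continuous_measurable => // u.
  apply: (@continuous_comp _ _ _ (fun u : R => r * u) expR).
    by apply: cvgMl_tmp; exact: cvg_id.
  exact: continuous_expR.
apply: measurable_funB => //.
apply: (measurableT_comp (f := @cos R)).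
  by apply: continuous_measurable => //; exact: continuous_cos.
apply: measurable_funM.
  apply: (@measurableT_comp _ _ _ _ _ _ (fun u : measurableTypeR R => expR (- u))) => //.
  apply: continuous_measurable => // u.
  apply: (@continuous_comp _ _ _ (fun u : R => - u) expR).
    by apply: cvgN; exact: cvg_id.
  exact: continuous_expR.
exact: (measurableT_comp mX).
Qed.

(** The measure is arbitrary because there are two uses: Lebesgue measure with the identity map
    gives measurability of [weight], and a probability gives the expectation of the weight of a
    random variable. *)
Lemma Tonelli_weight d (T : measurableType d) (m : {sigma_finite_measure set T -> \bar R})
    (X : T -> R) : measurable_fun setT X ->
  measurable_fun setT (fun w => weight (X w)) /\
  (\int[m]_w (weight (X w))%:E =
   \int[lam]_(u in `[0%R, +oo[) \int[m]_w (weight_fun u (X w))%:E)%E.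
Proof.
move=> mX.
pose F (z : measurableTypeR R * T) : \bar R :=
  (weight_fun z.1 (X z.2) * \1_(`[0%R, +oo[ : set R) z.1)%:E.
have mF : measurable_fun setT F.
  apply/measurable_EFinP; apply: measurable_funM; first exact: measurable_weight_fun2.
  have m1 : measurable_fun setT (\1_(`[0%R, +oo[ : set (measurableTypeR R)) : _ -> R).
    exact: measurable_indic.
  exact: (measurableT_comp m1 measurable_fst).
have F0 z : (0 <= F z)%E by rewrite lee_fin mulr_ge0// weight_fun_ge0.
have FE w : (\int[lam]_u F (u, w) = (weight (X w))%:E)%E.
  rewrite /weight /Rintegral fineK; last exact: integrable_fin_num (integrable_weight_fun _).
  rewrite [RHS]integral_mkcond; apply: eq_integral => u _.
  by rewrite patchE /F indicE/=; case: ifPn; rewrite ?mulr1 ?mulr0.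
split.
  apply/measurable_EFinP.
  apply: eq_measurable_fun (measurable_fun_fubini_tonelli_G (m1 := lam) F mF F0) => w _.
  by rewrite /= -FE.
under eq_integral do rewrite -FE.
rewrite -(fubini_tonelli (m1 := lam) (m2 := m) F mF F0) [RHS]integral_mkcond.
apply: eq_integral => u _; rewrite patchE /F/= indicE; case: ifPn => _.
  by apply: eq_integral => w _; rewrite mulr1.
by apply: integral0_eq => w _; rewrite mulr0.
Qed.

Lemma measurable_weight : measurable_fun setT (weight : measurableTypeR R -> R).
Proof.
exact: (proj1 (@Tonelli_weight _ _ lam (fun x : measurableTypeR R => x : R) _)).
Qed.

(* On the window [ln |x|, ln |x| + 1/2] the argument of the cosine lies
   between 1/2 and 1. *)
Definition weight_rate := (1 - cos 2^-1) / 2 * r.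

Lemma cos_half_lt1 : cos 2^-1 < 1 :> R.
Proof.
have h2 : 2^-1 <= pi :> R by have := pi_ge2 R; lra.
rewrite -[X in _ < X](cos0 R) ltr_cos ?in_itv/= ?lexx ?pi_ge0 ?h2 ?invr_ge0//.
by rewrite ler0n.
Qed.

Lemma weight_rate_gt0 : 0 < weight_rate.
Proof. by rewrite mulr_gt0// divr_gt0// subr_gt0 cos_half_lt1. Qed.

(** On the window, e^(r u) >= 1 + r u >= r ln |x| and 1 - cos is at least its value at 1/2, because
    e^(-1/2) >= 1/2; the window has length 1/2. This lower bound is crude, but entropy only asks for
    a logarithm. *)
Lemma weight_ge x : 1 <= `|x| -> weight_rate * ln `|x| <= weight x.
Proof.
move=> x1; set L := ln `|x|.
have x0 : 0 < `|x| by exact: lt_le_trans x1.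
have L0 : 0 <= L by exact: ln_ge0.
have sub : `[L, L + 2^-1] `<=` (`[0, +oo[ : set R).
  by move=> u /=; rewrite !in_itv/= andbT => /andP[+ _]; exact: le_trans.
have iw : lam.-integrable `[L, L + 2^-1] (EFin \o (weight_fun ^~ x)).
  by apply: integrableS (integrable_weight_fun x).
apply: (@le_trans _ _ (\int[lam]_(u in `[L, L + 2^-1]) weight_fun u x)); last first.
  apply: fine_le.
  - exact: integrable_fin_num iw.
  - exact: integrable_fin_num (integrable_weight_fun _).
  - apply: ge0_subset_integral => //.
    + by apply/measurable_EFinP/measurable_funTS; apply: continuous_measurable => //; exact: continuous_weight_fun.
    + by move=> u _; rewrite lee_fin weight_fun_ge0.
apply: (@le_trans _ _ (\int[lam]_(u in `[L, L + 2^-1]) (r * L * (1 - cos 2^-1)))).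
  rewrite Rintegral_cst//= lebesgue_measure_itv/= lte_fin ltrDl invr_gt0 ltr0n/=.
  rewrite /weight_rate le_eqVlt; apply/orP; left; apply/eqP; by field.
apply: le_Rintegral => //.
  by apply: integrable_itv => u; exact: cvg_cst.
move=> u /=; rewrite in_itv/= => /andP[Lu uL]; rewrite /weight_fun.
apply: ler_pM.
- by rewrite mulr_ge0// ltW.
- by rewrite subr_ge0 cos_le1.
- apply: le_trans (expR_ge1Dx _); have := ler_wpM2l (ltW r0) Lu; lra.
- rewrite lerD2l lerN2 -(cos_norm (expR _ * _)) normrM ger0_norm ?expR_ge0//.
  have -> : expR (- u) * `|x| = expR (L - u) by rewrite expRD mulrC lnK// posrE.
  have h1 : expR (L - u) <= 1 by rewrite -[leRHS]expR0 ler_expR subr_le0.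
  have h2 : 2^-1 <= expR (L - u) by apply: le_trans (expR_ge1Dx _); lra.
  have h3 := pi_ge2 R.
  by rewrite leNgt ltr_cos -?leNgt// in_itv/=; apply/andP; split; lra.
Qed.

(** For |x| >= 1, 1 + x^2 <= 2 x^2 reduces the claim to [weight_ge]; for |x| < 1, the term 2 ln 2
    suffices. The left-hand side is the factor of q in [xlnx_bound] at y = 1 + x^2. *)
Lemma ln_oneDsqr_le x : 2 * ln (1 + x ^+ 2) <= 2 * ln 2 + 4 / weight_rate * weight x.
Proof.
have w0 := weight_rate_gt0; have x2 := sqr_ge0 x.
have [x1|x1] := leP 1 `|x|.
  have xp : 0 < `|x| by exact: lt_le_trans x1.
  have : ln (1 + x ^+ 2) <= ln (2 * `|x| ^+ 2).
    rewrite ler_ln ?posrE ?ltr_wpDr// ?mulr_gt0// ?exprn_gt0//.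
    have : 1 <= `|x| ^+ 2 by rewrite expr_ge1.
    by rewrite real_normK ?num_real//; lra.
  rewrite lnM ?posrE ?exprn_gt0// lnXn// => h.
  have : ln `|x| <= weight x / weight_rate by rewrite ler_pdivlMr// mulrC weight_ge.
  have -> : 4 / weight_rate * weight x = 4 * (weight x / weight_rate) by ring.
  move: h; rewrite -mulr_natl; lra.
have : ln (1 + x ^+ 2) <= ln 2.
  rewrite ler_ln ?posrE ?ltr_wpDr//.
  have : `|x| ^+ 2 <= 1 by rewrite expr_le1// ltW.
  by rewrite real_normK ?num_real//; lra.
have : 0 <= 4 / weight_rate * weight x by rewrite mulr_ge0 ?weight_ge0// divr_ge0// ltW.
lra.
Qed.

End log_weight.

(** * Entropy of random variables with tame characteristic functions *)

Section tame.
Context (R : realType) (K r : R).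
Hypotheses (r0 : 0 < r) (r1 : r < 1).
Local Notation lam := (@lebesgue_measure R).

(** All that the entropy argument asks of a law, in terms of its characteristic function alone. The
    first clause yields a bounded continuous density. The second is a bound by K xi^(2r) at the
    frequencies xi = e^(-u) in ]0, 1]; it is written in u to match the weight. A common K along a
    family makes every estimate below uniform. *)
Definition tame d (T : measurableType d) (P : probability T R) (X : T -> R) :=
  (forall xi, 0 <= xi ->
    `|Ecos P X xi| <= K / (1 + xi ^+ 2) /\ `|Esin P X xi| <= K / (1 + xi ^+ 2)) /\
  (forall u, 0 <= u -> 1 - Ecos P X (expR (- u)) <= K * expR (- (2 * r * u))).

Section one_variable.
Context d (T : measurableType d) (P : probability T R) (X : {RV P >-> R}).
Hypothesis tX : tame P X.

Let decay := proj1 tX.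

Lemma tame_ge0 : 0 <= K.
Proof. exact: le_trans (fdens_norm_le decay 0). Qed.

Definition weight_spectrum (u : R) := expR (r * u) * (1 - Ecos P X (expR (- u))).

Lemma measurable_weight_spectrum :
  measurable_fun setT (weight_spectrum : measurableTypeR R -> R).
Proof.
apply: continuous_measurable => // u; apply: cvgM.
  apply: (@continuous_comp _ _ _ (fun u : R => r * u) expR).
    by apply: cvgMl_tmp; exact: cvg_id.
  exact: continuous_expR.
apply: cvgB; first exact: cvg_cst.
apply: (@continuous_comp _ _ _ (fun u : R => expR (- u)) (Ecos P X)).
  apply: (@continuous_comp _ _ _ (fun u : R => - u) expR).
    by apply: cvgN; exact: cvg_id.
  exact: continuous_expR.
exact: continuous_Ecos.
Qed.

Lemma weight_spectrum_le u : 0 <= u -> `|weight_spectrum u| <= K * expR (- (r * u)).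
Proof.
move=> u0; rewrite ger0_norm; last by rewrite mulr_ge0 ?expR_ge0// subr_ge0 Ecos_le1.
have -> : K * expR (- (r * u)) = expR (r * u) * (K * expR (- (2 * r * u))).
  by rewrite mulrCA -expRD; congr (_ * expR _); ring.
by rewrite ler_wpM2l ?expR_ge0//; apply: (proj2 tX).
Qed.

Lemma integrable_spectrum_bound : lam.-integrable `[0, +oo[
  (EFin \o (fun u => K * expR (- (r * u)))).
Proof. by apply: RintegrableZl => //; have [] := integral_expRN r0. Qed.

(** Both sides are the expectation of the weight of X: through the density on the left, through
    Tonelli on the right. The right-hand side involves only the characteristic function, and its
    integrand is dominated by K e^(-r u), whence finiteness. *)
Lemma weight_density :
  lam.-integrable setT (EFin \o (fun x => weight r x * fdens X x)) /\
  \int[lam]_x (weight r x * fdens X x) =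
  \int[lam]_(u in `[0, +oo[) weight_spectrum u.
Proof.
have dX := fdens_is_density decay.
have mw := measurable_weight r1.
have w0 x : 0 <= weight r x by exact: weight_ge0.
have f0 x : 0 <= fdens X x by exact: fdens_ge0 decay x.
have [_ TE] := @Tonelli_weight R r r1 _ T P X (measurable_funP X).
have DE := @ge0_integral_density _ _ _ P X _ (EFin \o weight r) dX
  (proj2 (measurable_EFinP _ _) mw) (fun x => ltac:(by rewrite lee_fin)).
have SE : (\int[lam]_(u in `[0%R, +oo[) \int[P]_w (weight_fun r u (X w))%:E =
    \int[lam]_(u in `[0%R, +oo[) (weight_spectrum u)%:E)%E.
  apply: eq_integral => u _.
  have ic : P.-integrable setT (EFin \o (fun w => 1 - cos (expR (- u) * X w))).
    apply: RintegrableB => //; first exact: finite_measure_integrable_cst.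
    exact: integrable_cosX.
  have iw : P.-integrable setT (EFin \o (fun w => weight_fun r u (X w))).
    exact: RintegrableZl.
  rewrite -[LHS]fineK; last exact: integrable_fin_num iw.
  congr EFin; rewrite -[LHS]/(\int[P]_w weight_fun r u (X w)) /weight_fun RintegralZl//.
  congr (_ * _); rewrite RintegralB//; last exact: integrable_cosX.
    by rewrite RintegralP_cst.
  exact: finite_measure_integrable_cst.
have is_ : lam.-integrable `[0, +oo[ (EFin \o weight_spectrum).
  apply: (Rintegrable_le _ _ integrable_spectrum_bound) => //.
    by apply: measurable_funTS; exact: measurable_weight_spectrum.
  by move=> u /=; rewrite in_itv/= andbT; exact: weight_spectrum_le.
have E : (\int[lam]_x (weight r x * fdens X x)%:E =
    \int[lam]_(u in `[0%R, +oo[) (weight_spectrum u)%:E)%E.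
  by rewrite -SE -TE DE; apply: eq_integral => x _; rewrite /= EFinM.
split; last by rewrite /Rintegral E.
apply/integrableP; split.
  apply/measurable_EFinP; apply: measurable_funM => //.
  by case: dX.
rewrite (eq_integral (fun x : measurableTypeR R => (weight r x * fdens X x)%:E)); last first.
  by move=> x _; rewrite gee0_abs// lee_fin mulr_ge0.
rewrite E -ge0_fin_numE; last first.
  apply: integral_ge0 => u _; rewrite lee_fin mulr_ge0 ?expR_ge0//.
  by rewrite subr_ge0 Ecos_le1.
exact: integrable_fin_num is_.
Qed.

(** The outcome of [xlnx_bound] with y = 1 + x^2 followed by [ln_oneDsqr_le]. The bound M is K + 1
    rather than K to ensure M >= 1. The result is affine in [fdens] and in the weighted density, so
    its integral is explicit. *)
Definition entropy_bound (x : R) :=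
  2 * (1 + x ^+ 2)^-1 +
  (ln (K + 1) + 2 * ln 2) * fdens X x +
  4 / weight_rate r * (weight r x * fdens X x).

Lemma xlnx_fdens_le x : `|fdens X x * ln (fdens X x)| <= entropy_bound x.
Proof.
have f0 : 0 <= fdens X x by exact: fdens_ge0 decay x.
have fK : fdens X x <= K + 1.
  have := le_trans (ler_norm _) (fdens_norm_le decay x); lra.
have K1 : 1 <= K + 1 by have := tame_ge0; lra.
have y1 : 1 <= 1 + x ^+ 2 by rewrite lerDl sqr_ge0.
apply: le_trans (xlnx_bound K1 y1 f0 fK) _; rewrite /entropy_bound.
have := ler_wpM2l f0 (ln_oneDsqr_le r0 r1 x); lra.
Qed.

Lemma integrable_fdens : lam.-integrable setT (EFin \o fdens X).
Proof. exact: density_integrable (fdens_is_density decay). Qed.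

Lemma integral_fdensT : \int[lam]_x fdens X x = 1.
Proof.
have [_ _ /(_ setT measurableT)] := fdens_is_density decay.
by rewrite probability_setT /Rintegral => <-.
Qed.

Lemma integrable_entropy_bound : lam.-integrable setT (EFin \o entropy_bound).
Proof.
have [iw _] := weight_density.
apply: RintegrableD => //; last exact: RintegrableZl.
apply: RintegrableD => //; apply: RintegrableZl => //.
  exact: integrable_oneDsqrVT.
exact: integrable_fdens.
Qed.

Lemma integral_entropy_bound : \int[lam]_x entropy_bound x =
  2 * \int[lam]_x (1 + x ^+ 2)^-1 + (ln (K + 1) + 2 * ln 2) +
  4 / weight_rate r * \int[lam]_(u in `[0, +oo[) weight_spectrum u.
Proof.
have [iw <-] := weight_density.
have i1 := @integrable_oneDsqrVT R; have i2 := integrable_fdens.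
rewrite RintegralD//; last exact: RintegrableZl.
  rewrite RintegralD//; [|exact: RintegrableZl|exact: RintegrableZl].
  congr (_ + _ + _); rewrite RintegralZl//.
  by rewrite integral_fdensT mulr1.
by apply: RintegrableD => //; apply: RintegrableZl.
Qed.

Lemma measurable_xlnx_fdens :
  measurable_fun setT ((fun x => fdens X x * ln (fdens X x)) : measurableTypeR R -> R).
Proof. by apply: measurable_xlnx; case: (fdens_is_density decay). Qed.

Lemma integrable_xlnx_fdens :
  lam.-integrable setT (EFin \o (fun x => fdens X x * ln (fdens X x))).
Proof.
apply: (Rintegrable_le _ _ integrable_entropy_bound) => //.
  exact: measurable_xlnx_fdens.
by move=> x _; exact: xlnx_fdens_le.
Qed.

Lemma tame_finite_entropy : finite_entropy X.
Proof. exact: finite_entropy_density (fdens_is_density decay) integrable_xlnx_fdens. Qed.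

Lemma tame_entropy : entropy X = - \int[lam]_x (fdens X x * ln (fdens X x)).
Proof. exact: entropy_density (fdens_is_density decay). Qed.

End one_variable.

Lemma tame_entropy_cvg d (T : measurableType d) (P : probability T R)
    (X : nat -> {RV P >-> R}) d' (T' : measurableType d') (Q : probability T' R)
    (Y : {RV Q >-> R}) :
  (forall n, tame P (X n)) -> tame Q Y ->
  (forall xi, 0 <= xi -> Ecos P (X n) xi @[n --> \oo] --> Ecos Q Y xi) ->
  (forall xi, 0 <= xi -> Esin P (X n) xi @[n --> \oo] --> Esin Q Y xi) ->
  entropy (X n) @[n --> \oo] --> entropy Y.
Proof.
move=> tX tY cC cS.
have cf x : fdens (X n) x @[n --> \oo] --> fdens Y x.
  apply: cvgMl_tmp.
  apply: (proj2 (@Rdominated_cvg _ _ _ lam `[0, +oo[ (fun n xi => trig (X n) xi x) _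
    (fun xi => 2 * K * (1 + xi ^+ 2)^-1) _ _ _ _ _)) => //.
  - by move=> n; apply: measurable_funTS; exact: measurable_trig.
  - move=> xi /=; rewrite in_itv/= andbT => xi0.
    by apply: cvgD; apply: cvgMr_tmp; [exact: cC|exact: cS].
  - exact: integrable_decay.
  - by move=> n xi /=; rewrite in_itv/= andbT; apply: trig_le; exact: (proj1 (tX n)).
rewrite (tame_entropy tY); under eq_fun do rewrite (tame_entropy (tX _)).
apply: cvgN.
apply: (@pratt _ _ _ lam (fun n x => fdens (X n) x * ln (fdens (X n) x))
  (fun n => entropy_bound (X n)) _ (entropy_bound Y)).
- by move=> n; exact: measurable_xlnx_fdens.
- by move=> x; apply: cvg_xlnx (cf x) => n; exact: fdens_ge0 (proj1 (tX n)) x.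
- move=> x; apply: cvgD; last by apply: cvgMl_tmp; apply: cvgMl_tmp.
  by apply: cvgD; [exact: cvg_cst|exact: cvgMl_tmp].
- by move=> n x; exact: xlnx_fdens_le.
- by move=> n; exact: integrable_entropy_bound.
- exact: integrable_entropy_bound.
(* In the integral of the dominating function only the spectral term depends on n, and ordinary
   dominated convergence applies to it with the bound K e^(-r u). *)
rewrite integral_entropy_bound//; under eq_fun do rewrite integral_entropy_bound//.
apply: cvgD; first exact: cvg_cst.
apply: cvgMl_tmp.
apply: (proj2 (@Rdominated_cvg _ _ _ lam `[0, +oo[ (fun n u => weight_spectrum (X n) u) _
    (fun u => K * expR (- (r * u))) _ _ _ _ _)) => //.
- by move=> n; apply: measurable_funTS; exact: measurable_weight_spectrum.
- move=> u _; apply: cvgMl_tmp; apply: cvgB; first exact: cvg_cst.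
  by apply: cC; exact: expR_ge0.
- exact: integrable_spectrum_bound.
- by move=> n u /=; rewrite in_itv/= andbT; exact: weight_spectrum_le.
Qed.

End tame.

(** * Scaling *)

Section scaling.
Context (R : realType) (c : R).
Hypothesis c0 : 0 < c.
Local Notation lam := (@lebesgue_measure R).

Let scale (x : measurableTypeR R) : measurableTypeR R := c * x.

Let measurable_scale : measurable_fun setT scale.
Proof. by apply: (continuous_measurable measurableT) => x; apply: cvgMl_tmp; exact: cvg_id. Qed.

(** Uniqueness of Lebesgue measure: c times its image under x --> c x gives every half-open interval
    its length. *)
Lemma lebesgue_measure_scale (A : set (measurableTypeR R)) : measurable A ->
  lam A = (c%:E * lam (scale @^-1` A))%E.
Proof.
pose cn := NngNum (ltW c0).
pose s : {mfun measurableTypeR R >-> measurableTypeR R} :=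
  HB.pack scale (isMeasurableFun.Build _ _ _ _ _ measurable_scale).
move=> mA; have := @lebesgue_measure_unique R (mscale cn (pushforward lam s)).
apply => // _ [[a b]] _ <- /=.
rewrite /mscale/= /pushforward/=.
have -> : scale @^-1` `]a, b] = `](c^-1 * a), (c^-1 * b)]%classic.
  by apply/seteqP; split=> x /=; rewrite !in_itv/= ltr_pdivrMl// ler_pdivlMl.
rewrite !lebesgue_measure_itv/= !lte_fin ltr_pM2l ?invr_gt0//.
case: ifPn; rewrite ?mule0// => _.
by rewrite -!EFinD -EFinM -mulrBr mulVKf// gt_eqF.
Qed.

Lemma ge0_integral_scale (g : R -> \bar R) :
  measurable_fun setT (g : measurableTypeR R -> \bar R) -> (forall x, (0 <= g x)%E) ->
  (\int[lam]_x g x = c%:E * \int[lam]_x g (c * x)%R)%E.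
Proof.
move=> mg g0.
pose cn := NngNum (ltW c0).
pose s : {mfun measurableTypeR R >-> measurableTypeR R} :=
  HB.pack scale (isMeasurableFun.Build _ _ _ _ _ measurable_scale).
rewrite (eq_measure_integral (mscale cn (pushforward lam s))); last first.
  by move=> A mA _; exact: lebesgue_measure_scale.
rewrite ge0_integral_mscale//; congr (_ * _)%E.
by rewrite ge0_integral_pushforward.
Qed.

Lemma integral_scale (g : R -> R) : lam.-integrable setT (EFin \o g) ->
  lam.-integrable setT (EFin \o (fun x => g (c * x))) /\
  \int[lam]_x g x = c * \int[lam]_x g (c * x).
Proof.
move=> ig; have mg := measurable_int _ ig.
have mgs : measurable_fun setT (EFin \o (fun x => g (c * x))).
  exact: (measurableT_comp mg measurable_scale).
have nc : c != 0 by rewrite gt_eqF.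
have igs : lam.-integrable setT (EFin \o (fun x => g (c * x))).
  apply/integrableP; split => //.
  have := ge0_integral_scale (measurableT_comp (@abse_measurable _ _) mg) (fun x => abse_ge0 _).
  move/(congr1 (fun y => c^-1%:E * y)%E).
  rewrite muleA -EFinM mulVf// mul1e => <-.
  apply: lte_mul_pinfty => //; first by rewrite lee_fin invr_ge0 ltW.
  by case/integrableP: ig.
split => //.
have pE := ge0_integral_scale (measurable_funepos mg) (fun x => funepos_ge0 _ x).
have nE := ge0_integral_scale (measurable_funeneg mg) (fun x => funeneg_ge0 _ x).
have -> : c * \int[lam]_x g (c * x) = fine (c%:E * \int[lam]_x (g (c * x)%R)%:E)%E.
  by rewrite fineM//; exact: integrable_fin_num igs.
rewrite /Rintegral; congr fine; rewrite integralE [in RHS]integralE pE nE [RHS]muleBr//.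
  by rewrite !unlock.
by rewrite fin_num_adde_defr//; exact: integrable_pos_fin_num igs.
Qed.

End scaling.

Section entropy_scaling.
Context (R : realType) (c : R).
Hypothesis c0 : 0 < c.
Local Notation lam := (@lebesgue_measure R).

Let scale (x : measurableTypeR R) : measurableTypeR R := c * x.

Let measurable_scale : measurable_fun setT scale.
Proof. by apply: (continuous_measurable measurableT) => x; apply: cvgMl_tmp; exact: cvg_id. Qed.

Context d (T : measurableType d) (P : probability T R) (X : {RV P >-> R}).

Lemma is_density_scale q : is_density X q ->
  is_density (scale_mfun c X : {RV P >-> R}) (fun x => c^-1 * q (c^-1 * x)).
Proof.
move=> [mq q0 qE].
have mq' : measurable_fun setT ((fun x => c^-1 * q (c^-1 * x)) : measurableTypeR R -> R).
  apply: measurable_funM => //; apply: (measurableT_comp mq).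
  by apply: (continuous_measurable measurableT) => x; apply: cvgMl_tmp; exact: cvg_id.
have nc : c != 0 by rewrite gt_eqF.
split => //.
  by move=> x; rewrite mulr_ge0 ?invr_ge0// ltW.
move=> A mA.
have mcA : measurable (scale @^-1` A).
  by rewrite -[X in measurable X]setTI; exact: measurable_scale.
transitivity (distribution P X (scale @^-1` A)).
  rewrite /distribution /pushforward; congr (P _); apply/seteqP.
  by split=> w /=; rewrite /scale mulrC.
rewrite qE// integral_mkcond [RHS]integral_mkcond [RHS](ge0_integral_scale c0).
- rewrite -ge0_integralZl//.
  + apply: eq_integral => x _; rewrite !patchE.
    have -> : (c * x \in A) = (x \in scale @^-1` A) by apply/idP/idP; rewrite !inE.
    by case: ifPn => _; rewrite ?mule0// -EFinM mulVKf// mulKf.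
  + apply: (measurableT_comp (f := ((fun x => (c^-1 * q (c^-1 * x))%:E) \_ A) : measurableTypeR R -> \bar R) _ measurable_scale).
    by apply/(measurable_restrictT _ _).1 => //; apply/measurable_funTS/measurable_EFinP.
  + by move=> x _; rewrite patchE; case: ifPn => _ //; rewrite lee_fin mulr_ge0 ?invr_ge0// ltW.
  + by rewrite lee_fin ltW.
- by apply/(measurable_restrictT _ _).1 => //; apply/measurable_funTS/measurable_EFinP.
- by move=> x; rewrite patchE; case: ifPn => _ //; rewrite lee_fin mulr_ge0 ?invr_ge0// ltW.
Qed.

Lemma entropy_scale q : is_density X q ->
  lam.-integrable setT (EFin \o (fun x => q x * ln (q x))) ->
  entropy (scale_mfun c X : {RV P >-> R}) = entropy X + ln c.
Proof.
move=> dq iq; have ds := is_density_scale dq.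
have [mq q0 qE] := dq; have iq1 := density_integrable dq.
have nc : c != 0 by rewrite gt_eqF.
have q1 : \int[lam]_x q x = 1.
  by have := qE setT measurableT; rewrite probability_setT /Rintegral => <-.
rewrite (entropy_density ds) (entropy_density dq).
pose f x := c^-1 * q (c^-1 * x) * ln (c^-1 * q (c^-1 * x)).
pose h x := q x * ln (q x) - ln c * q x.
have ih : lam.-integrable setT (EFin \o h) by apply: RintegrableB => //; exact: RintegrableZl.
(* At a zero of q both sides vanish thanks to the factor q; elsewhere the logarithm of the product
   splits. The term - ln c * q integrates to - ln c because q has mass 1. *)
have fE x : f (c * x) = c^-1 * h x.
  rewrite /f /h mulKf//; have := q0 x; rewrite le_eqVlt => /predU1P[<-|qx].
    by rewrite !(mulr0, mul0r, subr0).
  by rewrite lnM ?posrE ?invr_gt0// lnV ?posrE//; ring.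
have if_ : lam.-integrable setT (EFin \o f).
  have ci : 0 < c^-1 by rewrite invr_gt0.
  have [ihs _] := integral_scale ci ih.
  apply: eq_integrable (RintegrableZl c^-1 measurableT ihs) => // x _ /=.
  by rewrite -fE mulVKf.
have [_ ->] := integral_scale c0 if_.
under eq_Rintegral do rewrite fE.
rewrite RintegralZl// mulVKf//.
rewrite RintegralB//; last exact: RintegrableZl.
by rewrite RintegralZl// q1 mulr1 opprB addrC.
Qed.

End entropy_scaling.

(** * Characteristic functions *)

Section powers.
Context (R : realType).
Implicit Types p x : R.

Lemma cvgy_powR p : 0 < p -> x `^ p @[x --> +oo] --> +oo.
Proof.
move=> p0; apply/cvgryPge => M.
near=> x.
have M1 : 0 <= `|M| + 1 by rewrite addr_ge0.
apply: (@le_trans _ _ (`|M| + 1)).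
  by rewrite (le_trans (ler_norm _))// lerDl.
have -> : `|M| + 1 = ((`|M| + 1) `^ p^-1) `^ p.
  by rewrite -powRrM mulVf ?gt_eqF// powRr1.
have xM : (`|M| + 1) `^ p^-1 <= x by near: x; apply: nbhs_pinfty_ge; rewrite num_real.
apply: ge0_ler_powR => //; rewrite ?nnegrE ?powR_ge0 ?(ltW p0)//.
Unshelve. all: by end_near. Qed.

(** With z = x^p one has x^2 = e^((2/p) ln z). For a = k p / 2, the inequality ln (a z) <= a z
    multiplied by 2/p reads (2/p) (ln a + ln z) <= k z, which bounds x^2 e^(- k z) by e^(-(2/p) ln
    a). *)
Lemma stretched_expR_le (k p : R) : 0 < k -> 0 < p ->
  exists K, forall x, 0 <= x -> expR (- (k * x `^ p)) <= K / (1 + x ^+ 2).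
Proof.
move=> k0 p0; pose a := k * p / 2.
have a0 : 0 < a by rewrite divr_gt0// mulr_gt0.
exists (1 + expR (- (2 / p * ln a))) => x x0.
have d0 : 0 < 1 + x ^+ 2 by rewrite ltr_wpDr ?sqr_ge0.
rewrite ler_pdivlMr// mulrC expRN ler_pdivrMr ?expR_gt0// mulrDl mul1r.
have e1 : 1 <= expR (k * x `^ p).
  by rewrite -[leLHS]expR0 ler_expR mulr_ge0 ?powR_ge0// ltW.
apply: lerD => //; rewrite -expRD.
move: x0; rewrite le_eqVlt => /predU1P[<-|x0].
  by rewrite expr0n expR_ge0.
have z0 : 0 < x `^ p by exact: powR_gt0.
have -> : x ^+ 2 = expR (2 / p * ln (x `^ p)).
  rewrite ln_powR mulrA divfK ?gt_eqF// -[2 in RHS]/(2%:R) mulr_natl.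
  by rewrite -lnXn// lnK// posrE exprn_gt0.
rewrite ler_expR.
have : ln a + ln (x `^ p) <= a * x `^ p.
  by rewrite -lnM ?posrE//; apply/ltW/ln_sublinear; rewrite mulr_gt0.
have p2 : 0 < 2 / p by rewrite divr_gt0.
move/(ler_wpM2l (ltW p2)).
have -> : 2 / p * (a * x `^ p) = k * x `^ p.
  by rewrite /a; field; rewrite gt_eqF.
lra.
Qed.

End powers.

Section characteristic_functions.
Context (R : realType) d (T : measurableType d) (P : probability T R).
Variable X : {RV P >-> R}.

Lemma Ecos_scale (c xi : R) : Ecos P (scale_mfun c X) xi = Ecos P X (c * xi).
Proof. by apply: eq_Rintegral => w _ /=; congr (cos _); ring. Qed.

Lemma Esin_scale (c xi : R) : Esin P (scale_mfun c X) xi = Esin P X (c * xi).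
Proof. by apply: eq_Rintegral => w _ /=; congr (sin _); ring. Qed.

Lemma EcosN (xi : R) : Ecos P X (- xi) = Ecos P X xi.
Proof. by apply: eq_Rintegral => w _; rewrite mulNr cosN. Qed.

Lemma EsinN (xi : R) : Esin P X (- xi) = - Esin P X xi.
Proof.
rewrite -[RHS]mulN1r /Esin -RintegralZl//; last exact: integrable_sinX.
by apply: eq_Rintegral => w _; rewrite mulNr sinN mulN1r.
Qed.

Lemma Ecos0 : Ecos P X 0 = 1.
Proof.
rewrite -[RHS](RintegralP_cst P 1).
by apply: eq_Rintegral => w _; rewrite mul0r cos0.
Qed.

Lemma integrable_onem_cos (xi : R) :
  P.-integrable setT (EFin \o (fun w => 1 - cos (xi * X w))).
Proof.
apply: RintegrableB => //; first exact: finite_measure_integrable_cst.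
exact: integrable_cosX.
Qed.

Lemma onem_Ecos (xi : R) : 1 - Ecos P X xi = \int[P]_w (1 - cos (xi * X w)).
Proof.
rewrite RintegralB//; [|exact: finite_measure_integrable_cst|exact: integrable_cosX].
by rewrite RintegralP_cst.
Qed.

(** The nonnegative variable 1 - cos (xi X) has mean 0, so almost surely cos (X / (n+1)) = 1 for all
    n at once. Taking n + 1 > |X| brings the argument into [0, 1], where the cosine is injective. *)
Lemma Ecos_eq1_ae0 : (forall xi, 0 < xi -> Ecos P X xi = 1) ->
  {ae P, forall w, X w = 0}.
Proof.
move=> X1.
have aen n : {ae P, forall w, cos (n.+1%:R^-1 * X w) = 1}.
  have i0 : \int[P]_w (1 - cos (n.+1%:R^-1 * X w)) = 0.
    by rewrite -onem_Ecos X1 ?subrr// invr_gt0.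
  have ic := integrable_onem_cos n.+1%:R^-1.
  have e0 : (\int[P]_w `|(1 - cos (n.+1%:R^-1 * X w))%:E| = 0)%E.
    rewrite -[RHS]/(0%:E) -i0 /Rintegral fineK; last exact: integrable_fin_num ic.
    by apply: eq_integral => w _; rewrite gee0_abs// lee_fin subr_ge0 cos_le1.
  have mc := measurable_int _ ic.
  have := (proj1 (ae_eq_integral_abs P measurableT mc)) e0.
  by apply: filterS => w /(_ I)[] /eqP; rewrite subr_eq0 => /eqP.
have := ae_foralln aen; apply: filterS => w cw.
apply/eqP; apply: contrapT => /negP Xw; have Xw0 : 0 < `|X w| by rewrite normr_gt0.
pose n := Num.truncn `|X w|.
have nX : `|X w| < n.+1%:R by exact: truncnS_gt.
have := cw n; rewrite -cos_norm normrM ger0_norm ?invr_ge0// => c1.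
have y0 : 0 < n.+1%:R^-1 * `|X w| by rewrite mulr_gt0// invr_gt0.
have y1 : n.+1%:R^-1 * `|X w| <= 1 by rewrite ler_pdivrMl// mulr1 ltW.
have := pi_ge2 R => p2.
have : n.+1%:R^-1 * `|X w| = 0.
  apply: cos_inj; rewrite ?in_itv/= ?lexx ?pi_ge0 ?(ltW y0)//; last by rewrite c1 cos0.
  by apply: le_trans y1 _; lra.
by move=> h; rewrite h ltxx in y0.
Qed.

(** Two pointwise bounds: 1 - cos y <= 2 |y|^q, which needs q <= 1, and |X|^q <= 1 + |X|^p, which
    needs q <= p. *)
Lemma onem_Ecos_le_moment (p q : R) : 0 < p -> 0 < q -> q <= p -> q <= 1 ->
  ('E_P[fun w => (`|X w| `^ p)%R] < +oo)%E ->
  exists2 K, 0 <= K & forall xi, 0 <= xi -> 1 - Ecos P X xi <= K * xi `^ q.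
Proof.
move=> p0 q0 qp q1 Xp.
have mXp : measurable_fun setT (fun w => `|X w| `^ p).
  apply: (measurableT_comp (f := (@powR R) ^~ p)); first exact: measurable_powR.
  exact: measurableT_comp.
have iXp : P.-integrable setT (EFin \o (fun w => `|X w| `^ p)).
  apply/integrableP; split; first exact/measurable_EFinP.
  move: Xp; rewrite unlock; apply: le_lt_trans.
  by rewrite le_eqVlt; apply/orP; left; apply/eqP; apply: eq_integral => w _; rewrite /= ger0_norm ?powR_ge0.
have i1 : P.-integrable setT (EFin \o (fun w => 2 * (1 + `|X w| `^ p))).
  apply: RintegrableZl => //; apply: RintegrableD => //.
  exact: finite_measure_integrable_cst.
exists (\int[P]_w (2 * (1 + `|X w| `^ p))).
  by apply: Rintegral_ge0 => w _; rewrite mulr_ge0// addr_ge0// powR_ge0.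
move=> xi xi0; rewrite onem_Ecos mulrC -RintegralZl//; apply: le_Rintegral => //.
- exact: integrable_onem_cos.
- exact: RintegrableZl.
move=> w _; pose y := `|xi * X w|.
have y0 : 0 <= y by exact: normr_ge0.
have h1 : 1 - cos (xi * X w) <= 2 * y `^ q.
  have [y1|y1] := leP y 1.
    apply: le_trans (onem_cos_le _) _; rewrite -/y.
    move: y0; rewrite le_eqVlt => /predU1P[<-|y0]; first by rewrite mulr_ge0// powR_ge0.
    have := @ger1_powR _ y q; rewrite y0 y1 => /(_ isT q1) h.
    have := powR_ge0 y q; lra.
  have : 1 <= y `^ q by rewrite -[leLHS](powRr0 y); apply: ler_powR; exact: ltW.
  have := cos_geN1 (xi * X w); lra.
apply: le_trans h1 _.
rewrite /y normrM (ger0_norm xi0) powRM//.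
rewrite mulrCA ler_wpM2l ?powR_ge0// ler_wpM2l//.
have [x1|x1] := leP `|X w| 1.
  have : `|X w| `^ q <= 1 `^ q by apply: ge0_ler_powR; rewrite ?nnegrE ?(ltW q0).
  by rewrite powR1 => h; apply: le_trans h _; rewrite lerDl powR_ge0.
have : `|X w| `^ q <= `|X w| `^ p by apply: ler_powR => //; exact: ltW.
lra.
Qed.

End characteristic_functions.

(** * The exponent of a Levy process *)

Section levy_exponent.
Context (R : realType) d (T : measurableType d) (P : probability T R).
Variables (L : R -> {RV P >-> R}) (A B : R -> R) (Cs : R).
Hypothesis EcosL : forall t xi, 0 <= t ->
  Ecos P (L t) xi = expR (t * A xi) * cos (t * B xi).
Hypothesis EsinL : forall t xi, 0 <= t ->
  Esin P (L t) xi = expR (t * A xi) * sin (t * B xi).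
Hypothesis Cs0 : 0 < Cs.
Hypothesis sector : forall xi, `|B xi| <= Cs * `|A xi|.

Lemma EcosEsin_sqr t xi : 0 <= t ->
  Ecos P (L t) xi ^+ 2 + Esin P (L t) xi ^+ 2 = expR (2 * (t * A xi)).
Proof.
move=> t0; rewrite EcosL// EsinL// !exprMn -mulrDr cos2Dsin2 mulr1.
by rewrite expr2 -expRD; congr expR; ring.
Qed.

(* e^{2 t A} <= 2 for every t >= 0 *)
Lemma exponent_le0 xi : A xi <= 0.
Proof.
rewrite leNgt; apply/negP => A0.
have := EcosEsin_sqr xi (ltW (_ : 0 < (A xi)^-1)); rewrite invr_gt0 => /(_ A0).
rewrite mulVf ?gt_eqF// mulr1 => E.
have h1 : Ecos P (L (A xi)^-1) xi ^+ 2 <= 1.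
  by rewrite -real_normK ?num_real// expr_le1// norm_Ecos_le1.
have h2 : Esin P (L (A xi)^-1) xi ^+ 2 <= 1.
  by rewrite -real_normK ?num_real// expr_le1// norm_Esin_le1.
have := expR_ge1Dx (2 : R); lra.
Qed.

(** The real part of the exponent is recovered from the modulus of the characteristic function of
    L_1 by a real logarithm, so that evenness and continuity pass to [A]. *)
Lemma exponentE xi : A xi = 2^-1 * ln (Ecos P (L 1) xi ^+ 2 + Esin P (L 1) xi ^+ 2).
Proof. by rewrite EcosEsin_sqr// expRK mul1r mulKf. Qed.

Lemma exponentN xi : A (- xi) = A xi.
Proof. by rewrite !exponentE EcosN EsinN sqrrN. Qed.

Lemma continuous_exponent : continuous A.
Proof.
rewrite (funext exponentE) => x; apply: cvgMl_tmp.
apply: continuous_cvg; last first.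
  have cE : Ecos P (L 1) y @[y --> x] --> Ecos P (L 1) x by exact: continuous_Ecos.
  have sE : Esin P (L 1) y @[y --> x] --> Esin P (L 1) x by exact: continuous_Esin.
  by apply: cvgD; [exact: (cvgM cE cE)|exact: (cvgM sE sE)].
by apply: continuous_ln; rewrite EcosEsin_sqr// expR_gt0.
Qed.

(** Write the left-hand side as (1 - e^(tA)) + e^(tA) (1 - cos (tB)); the first term is at most t
    |A|, the second at most t |B|, and the sector condition turns the latter into Cs t |A|. *)
Lemma onem_EcosL_le t xi : 0 <= t ->
  1 - Ecos P (L t) xi <= (1 + Cs) * (t * `|A xi|).
Proof.
move=> t0; rewrite EcosL//.
have a0 := exponent_le0 xi.
have -> : `|A xi| = - A xi by rewrite ler0_norm.
have ta : t * A xi <= 0 by rewrite mulr_ge0_le0.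
have e1 : expR (t * A xi) <= 1 by rewrite -[leRHS]expR0 ler_expR.
have e2 := expR_ge1Dx (t * A xi).
have c0 : 0 <= 1 - cos (t * B xi) by rewrite subr_ge0 cos_le1.
have c1 := onem_cos_le (t * B xi).
have c2 : `|t * B xi| <= Cs * (t * - A xi).
  rewrite normrM ger0_norm// mulrCA ler_wpM2l//.
  by have := sector xi; rewrite (ler0_norm a0).
have := ler_wpM2r c0 e1; lra.
Qed.

Context d' (T' : measurableType d') (Q : probability T' R).
Variables (Y : R -> {RV Q >-> R}) (H : R).
Hypothesis cvgC : forall t xi, 0 <= t ->
  Ecos P (L (t / a)) (a `^ H * xi) @[a --> +oo] --> Ecos Q (Y t) xi.
Hypothesis cvgS : forall t xi, 0 <= t ->
  Esin P (L (t / a)) (a `^ H * xi) @[a --> +oo] --> Esin Q (Y t) xi.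
Hypothesis symY : forall t xi, 0 <= t -> Esin Q (Y t) xi = 0.
Hypothesis nontrivialY : exists2 t, 0 <= t & ~ {ae Q, forall w, Y t w = 0}.

Let c xi := Ecos Q (Y 1) xi.

(** By the sector condition B(a^H xi)/a would vanish in the limit as well, so the characteristic
    function of every Y_t would be 1 and the limit process trivial. *)
Lemma exponent_not_vanishing :
  ~ (forall xi, 0 < xi -> A (a `^ H * xi) / a @[a --> +oo] --> (0 : R)).
Proof.
move=> van; have [t t0] := nontrivialY; apply; apply: Ecos_eq1_ae0 => xi xi0.
have vA : t * (A (a `^ H * xi) / a) @[a --> +oo] --> (0 : R).
  by rewrite -[X in _ --> X](mulr0 t); apply: cvgMl_tmp; exact: van.
have vB : t * (B (a `^ H * xi) / a) @[a --> +oo] --> (0 : R).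
  apply/norm_cvg0P.
  have vA' : Cs * `|t * (A (a `^ H * xi) / a)| @[a --> +oo] --> (0 : R).
    by rewrite -[X in _ --> X](mulr0 Cs); apply: cvgMl_tmp; exact/norm_cvg0P.
  apply: (squeeze_cvgr _ (cvg_cst 0) vA'); apply: nearW => a.
  rewrite normr_ge0/= !normrM [leRHS]mulrCA ler_wpM2l// mulrA ler_wpM2r//.
have e1 : expR (t * (A (a `^ H * xi) / a)) * cos (t * (B (a `^ H * xi) / a))
    @[a --> +oo] --> (1 : R).
  rewrite -[X in _ --> X](mulr1 1) -{1}(expR0 R) -(cos0 R).
  apply: cvgM; apply: continuous_cvg => //; first exact: continuous_expR.
  exact: continuous_cos.
apply: (cvg_unique _ (cvgC t0 (xi := xi))) => //.
apply: cvg_trans e1; apply: near_eq_cvg; near=> a.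
have a0 : 0 < a by near: a; exact: nbhs_pinfty_gt.
by rewrite EcosL ?divr_ge0// ?ltW//; congr (expR _ * cos _); ring.
Unshelve. all: by end_near. Qed.

(** Squared moduli eliminate B before the limit; after it, symmetry of Y leaves only the square of
    the real part. *)
Lemma cvg_exponent_sqr xi :
  expR (2 * (A (a `^ H * xi) / a)) @[a --> +oo] --> c xi ^+ 2.
Proof.
have : Ecos P (L (1 / a)) (a `^ H * xi) ^+ 2 + Esin P (L (1 / a)) (a `^ H * xi) ^+ 2
    @[a --> +oo] --> c xi ^+ 2 + Esin Q (Y 1) xi ^+ 2.
  have cE := cvgC (xi := xi) ler01; have sE := cvgS (xi := xi) ler01.
  by apply: cvgD; [exact: (cvgM cE cE)|exact: (cvgM sE sE)].
rewrite symY// [0 ^+ 2]expr0n addr0; apply: cvg_trans; apply: near_eq_cvg; near=> a.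
have a0 : 0 < a by near: a; exact: nbhs_pinfty_gt.
by rewrite EcosEsin_sqr ?divr_ge0// ?ltW//; congr expR; ring.
Unshelve. all: by end_near. Qed.

Lemma Ecos_gt0_near0 : exists2 xi, 0 < xi & 0 < c xi.
Proof.
have c0 : c 0 = 1 by exact: Ecos0.
have : \forall x \near (0 : R), 0 < c x.
  have := @continuous_Ecos _ _ _ Q (Y 1) 0; rewrite -/c => cc.
  by apply: (cvgr_gt _ cc); rewrite Ecos0.
move=> [e /= e0 he]; exists (e / 2); first by rewrite divr_gt0.
by apply: he => /=; rewrite sub0r normrN gtr0_norm ?divr_gt0//; lra.
Qed.

(** The square determines the limit only up to sign, hence the positivity hypothesis; at this stage
    it can be supplied only at a frequency given by [Ecos_gt0_near0]. *)
Lemma cvg_exponent xi : 0 < c xi ->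
  A (a `^ H * xi) / a @[a --> +oo] --> ln (c xi).
Proof.
move=> cx.
have -> : ln (c xi) = 2^-1 * ln (c xi ^+ 2) by rewrite lnXn// -(mulr_natl (ln _)) mulKf.
have -> : (fun a => A (a `^ H * xi) / a) =
    (fun a => 2^-1 * ln (expR (2 * (A (a `^ H * xi) / a)))).
  by apply/funext => a; rewrite expRK mulKf.
apply: cvgMl_tmp; apply: continuous_cvg; last exact: cvg_exponent_sqr.
by apply: continuous_ln; rewrite exprn_gt0.
Qed.

(** If H <= 0, then a^H xi stays in [0, xi] for a >= 1, where the continuous [A] is bounded; hence
    A(a^H xi)/a --> 0, which [exponent_not_vanishing] forbids. *)
Lemma H_gt0 : 0 < H.
Proof.
rewrite ltNge; apply/negP => H0; apply: exponent_not_vanishing => xi xi0.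
have cA : {within `[0, xi], continuous (fun x => - A x)}.
  by apply: continuous_subspaceT => x; apply: cvgN; exact: continuous_exponent.
have [m mi mm] := EVT_max (ltW xi0) cA.
have M0 : `|A m| / a @[a --> +oo] --> (0 : R).
  rewrite -[X in _ --> X](mulr0 (`|A m|)); apply: cvgMl_tmp.
  apply: (proj2 (@gtr0_cvgV0 _ _ _ _ (fun a : R => a) _)); last exact: cvg_id.
  exact: nbhs_pinfty_gt.
apply/norm_cvg0P; apply: (squeeze_cvgr _ (cvg_cst 0) M0); near=> a.
have a1 : 1 <= a by near: a; exact: nbhs_pinfty_ge.
have a0 : 0 < a by exact: lt_le_trans a1.
rewrite normr_ge0/= normrM normfV (gtr0_norm a0) ler_pM2r ?invr_gt0//.
rewrite !ler0_norm ?exponent_le0//; apply: mm.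
rewrite in_itv/= mulr_ge0 ?powR_ge0 ?(ltW xi0)//= ler_piMl ?(ltW xi0)//.
by rewrite -[leRHS](powRr0 a); exact: ler_powR.
Unshelve. all: by end_near. Qed.

Let al := H^-1.

Let al0 : 0 < al. Proof. by rewrite invr_gt0 H_gt0. Qed.

(** A single frequency xi with c xi > 0 is enough: the substitution a = (x/xi)^(1/H) makes a^H xi
    run through all large x. The constant is g = - ln (c xi) / xi^(1/H), and g = 0 would again make
    A(a^H y)/a vanish for every y. *)
Lemma exponent_asymp : exists2 g : R, 0 < g &
  A x / x `^ al @[x --> +oo] --> - g.
Proof.
have [xi xi0 cx] := Ecos_gt0_near0.
pose g := - ln (c xi) / xi `^ al.
have xa : 0 < xi `^ al by exact: powR_gt0.
have lim : A x / x `^ al @[x --> +oo] --> - g.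
  have h1 : A x / (x / xi) `^ al @[x --> +oo] --> ln (c xi).
    have cy : (x / xi) `^ al @[x --> +oo] --> +oo.
      apply: (@cvg_comp _ _ _ (fun x => x / xi) (fun y => y `^ al) _ (pinfty_nbhs R)).
        by apply: gt0_cvgMly; [rewrite invr_gt0|exact: cvg_id].
      exact: cvgy_powR.
    have := cvg_comp _ _ cy (cvg_exponent cx); apply: cvg_trans.
    apply: near_eq_cvg; near=> x.
    have x0 : 0 < x by near: x; exact: nbhs_pinfty_gt.
    rewrite /= -powRrM mulVf ?gt_eqF ?H_gt0// powRr1 ?divr_ge0 ?ltW//.
    by rewrite divfK ?gt_eqF.
  have -> : - g = ln (c xi) * (xi `^ al)^-1 by rewrite /g mulNr opprK.
  have h2 : A x / (x / xi) `^ al * (xi `^ al)^-1 @[x --> +oo] -->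
      ln (c xi) * (xi `^ al)^-1 by exact: cvgMr_tmp.
  apply: cvg_trans h2; apply: near_eq_cvg; near=> x.
  have x0 : 0 < x by near: x; exact: nbhs_pinfty_gt.
  have -> : x `^ al = (x / xi) `^ al * xi `^ al.
    by rewrite -powRM ?divr_ge0 ?ltW// divfK ?gt_eqF.
  by rewrite invfM mulrA.
exists g => //.
have g0 : 0 <= g.
  rewrite -oppr_le0; apply: (cvgr_to_le lim); near=> x.
  by rewrite mulr_le0_ge0 ?exponent_le0// invr_ge0 powR_ge0.
rewrite lt_neqAle g0 andbT; apply/eqP => g0'; apply: exponent_not_vanishing => y y0.
have cy : a `^ H * y @[a --> +oo] --> +oo.
  by apply: gt0_cvgMly => //; apply: cvgy_powR; exact: H_gt0.
have := cvg_comp _ _ cy lim; rewrite -g0' oppr0 => h.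
have h2 : A (a `^ H * y) / (a `^ H * y) `^ al * y `^ al @[a --> +oo] --> (0 : R).
  by rewrite -[X in _ --> X](mul0r (y `^ al)); apply: cvgMr_tmp.
apply: cvg_trans h2; apply: near_eq_cvg; near=> a.
have a0 : 0 < a by near: a; exact: nbhs_pinfty_gt.
rewrite powRM ?powR_ge0 ?ltW// -powRrM mulfV ?gt_eqF ?H_gt0// powRr1 ?(ltW a0)//.
by rewrite invfM mulrA divfK// gt_eqF// powR_gt0.
Unshelve. all: by end_near. Qed.

End levy_exponent.

(** * Consequences of the power asymptotics of the exponent *)

Section regular_exponent.
Context (R : realType) (A : R -> R) (al g : R).
Hypothesis A_le0 : forall x, A x <= 0.
Hypothesis AN : forall x, A (- x) = A x.
Hypothesis cA : continuous A.
Hypothesis al0 : 0 < al.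
Hypothesis g0 : 0 < g.
Hypothesis asympA : A x / x `^ al @[x --> +oo] --> - g.

Lemma asymp_norm : `|A x| / x `^ al @[x --> +oo] --> g.
Proof.
have -> : (fun x => `|A x| / x `^ al) = (fun x => - (A x / x `^ al)).
  by apply/funext => x; rewrite ler0_norm// mulNr.
by rewrite -[X in _ --> X]opprK; exact: cvgN.
Qed.

Lemma asymp_bounds : exists2 r, 1 <= r & forall x, r <= x ->
  g / 2 * x `^ al <= `|A x| <= 2 * g * x `^ al.
Proof.
have h1 : \forall x \near +oo, g / 2 <= `|A x| / x `^ al.
  by apply: (cvgr_ge _ asymp_norm); have := g0; lra.
have h2 : \forall x \near +oo, `|A x| / x `^ al <= 2 * g.
  by apply: (cvgr_le _ asymp_norm); have := g0; lra.
have : \forall x \near +oo, [/\ 0 < x, g / 2 <= `|A x| / x `^ al & `|A x| / x `^ al <= 2 * g].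
  near=> x; split.
  - by near: x; exact: nbhs_pinfty_gt.
  - by near: x; exact: h1.
  - by near: x; exact: h2.
move=> [M [_ hM]]; exists (Num.max 1 (M + 1)); first by rewrite le_max lexx.
move=> x; rewrite ge_max => /andP[x1 xM].
have [x0 h3 h4] : [/\ 0 < x, g / 2 <= `|A x| / x `^ al & `|A x| / x `^ al <= 2 * g].
  by apply: hM; lra.
have xa : 0 < x `^ al by exact: powR_gt0.
by move: h3 h4; rewrite ler_pdivlMr// ler_pdivrMr// => -> ->.
Unshelve. all: by end_near. Qed.

(** Stated for an auxiliary h so that it serves for |Psi(x)| and for |Psi(-x)|, that is, at both
    ends of the line. *)
Lemma cvg0_of_le_exponent (h : R -> R) (k p : R) : al < p ->
  (forall x, 0 <= h x <= k * `|A x|) ->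
  h x / `|x| `^ p @[x --> +oo] --> (0 : R).
Proof.
move=> alp hA.
have l0 : k * (`|A x| / x `^ al * (x `^ (p - al))^-1) @[x --> +oo] --> (0 : R).
  rewrite -[X in _ --> X](mulr0 k); apply: cvgMl_tmp.
  rewrite -[X in _ --> X](mulr0 g); apply: cvgM; first exact: asymp_norm.
  apply: (proj2 (@gtr0_cvgV0 _ _ _ _ (fun x : R => x `^ (p - al)) _)).
    by near=> x; apply: powR_gt0; near: x; exact: nbhs_pinfty_gt.
  by apply: cvgy_powR; rewrite subr_gt0.
apply: (squeeze_cvgr _ (cvg_cst 0) l0); near=> x.
have x0 : 0 < x by near: x; exact: nbhs_pinfty_gt.
have /andP[h1 h2] := hA x.
rewrite gtr0_norm// [x `^ p](_ : _ = x `^ al * x `^ (p - al)); last first.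
  rewrite -powRD; last by rewrite (gt_eqF x0) implybT.
  by rewrite addrC subrK.
rewrite divr_ge0 ?mulr_ge0 ?powR_ge0//=.
have -> : k * (`|A x| / x `^ al / x `^ (p - al)) =
    k * `|A x| / (x `^ al * x `^ (p - al)) by rewrite invfM !mulrA.
by rewrite ler_wpM2r// invr_ge0 mulr_ge0 ?powR_ge0.
Unshelve. all: by end_near. Qed.

Lemma norm_complex_bounds (z : R[i]) :
  `|complex.Re z| <= Normc.normc z <= `|complex.Re z| + `|complex.Im z|.
Proof.
case: z => a b /=; apply/andP; split.
  by rewrite -sqrtr_sqr ler_wsqrtr// lerDl sqr_ge0.
rewrite -[leRHS]ger0_norm ?addr_ge0// -sqrtr_sqr ler_wsqrtr//.
rewrite sqrrD !real_normK ?num_real//.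
have := mulr_ge0 (normr_ge0 a) (normr_ge0 b); rewrite -mulr_natl; lra.
Qed.

(** The sector condition gives |A| <= |Psi| <= (1 + C) |A|. Hence every p > al is admissible, while
    p < al would force g <= 0 by comparing |A|/x^al with |Psi|/x^p for x >= 1. *)
Lemma BG_indexE (Psi : R -> R[i]) (C : R) : 0 < C ->
  (forall x, complex.Re (Psi x) = A x) ->
  (forall x, `|complex.Im (Psi x)| <= C * `|complex.Re (Psi x)|) ->
  BG_index Psi = al.
Proof.
move=> C0 RePsi sectorPsi.
pose N x := Normc.normc (Psi x).
have NA x : `|A x| <= N x <= (1 + C) * `|A x|.
  have /andP[h1 h2] := norm_complex_bounds (Psi x).
  have := sectorPsi x; rewrite -RePsi h1/= => h3; rewrite /N; lra.
have inS p : al < p -> [/\ 0 < p, N x / `|x| `^ p @[x --> +oo] --> (0 : R) &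
    N x / `|x| `^ p @[x --> -oo] --> (0 : R)].
  move=> alp; split.
  - exact: lt_trans alp.
  - apply: (cvg0_of_le_exponent (k := 1 + C)) => // x.
    by have /andP[h1 ->] := NA x; rewrite (le_trans _ h1).
  - apply/cvgNy_compNP.
    have -> : (fun x => N (- x) / `|- x| `^ p) = (fun x => N (- x) / `|x| `^ p).
      by apply/funext => x; rewrite normrN.
    apply: (cvg0_of_le_exponent (h := fun x => N (- x)) (k := 1 + C)) => // x.
    by have := NA (- x); rewrite AN => /andP[h1 ->]; rewrite (le_trans _ h1).
have lbS p : 0 < p -> N x / `|x| `^ p @[x --> +oo] --> (0 : R) -> al <= p.
  move=> p0 Np; rewrite leNgt; apply/negP => pal.
  have : g <= 0.
    apply: (ler_cvg_to asymp_norm Np); near=> x.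
    have x1 : 1 <= x by near: x; exact: nbhs_pinfty_ge.
    have x0 : 0 < x by exact: lt_le_trans x1.
    rewrite (gtr0_norm x0); have /andP[h1 _] := NA x.
    apply: ler_pM => //; first by rewrite invr_ge0 powR_ge0.
    by rewrite lef_pV2 ?posrE ?powR_gt0// ler_powR// ltW.
  by rewrite leNgt g0.
apply/eqP; rewrite eq_le; apply/andP; split.
  apply/ler_addgt0Pr => e e0; apply: ge_inf.
    by exists 0 => p [/ltW].
  by apply: inS; rewrite ltrDl.
apply: lb_le_inf.
  by exists (al + 1); apply: inS; rewrite ltrDl.
by move=> p [p0 Np _]; exact: lbS.
Unshelve. all: by end_near. Qed.

(** The moment condition bounds 1 - e^(2A); passing to |A| costs a constant depending on the maximum
    of |A| over [0, r]. The sign of [K] is not prescribed, hence its absolute value. *)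
Lemma exponent_le_near0 (K q r : R) : 0 <= r ->
  (forall x, 0 <= x -> 1 - expR (2 * A x) <= K * x `^ q) ->
  exists2 K', 0 <= K' & forall x, 0 <= x -> x <= r -> `|A x| <= K' * x `^ q.
Proof.
move=> r0 AK.
have [m _ mm] := EVT_max r0 (continuous_subspaceT (fun x => cvgN (@cA x))).
have m0 : 0 <= - A m by rewrite oppr_ge0.
exists ((1 + 2 * - A m) * `|K|); first by rewrite mulr_ge0// addr_ge0// mulr_ge0.
move=> x x0 xr; rewrite ler0_norm//.
have xm : - A x <= - A m by apply: mm; rewrite in_itv/= x0.
have Ax0 := A_le0 x.
have hK : 1 - expR (2 * A x) <= `|K| * x `^ q.
  by apply: le_trans (AK _ x0) _; rewrite ler_wpM2r ?powR_ge0// ler_norm.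
have Kx0 : 0 <= `|K| * x `^ q by rewrite mulr_ge0// powR_ge0.
have E : expR (2 * A x) * (1 + 2 * - A x) <= 1.
  have := expR_ge1Dx (2 * - A x) => h.
  apply: (@le_trans _ _ (expR (2 * A x) * expR (2 * - A x))).
    by rewrite ler_wpM2l ?expR_ge0.
  by rewrite -expRD -mulrDr subrr mulr0 expR0.
have e0 := expR_gt0 (2 * A x).
rewrite -mulrA; set w := `|K| * x `^ q in hK Kx0 *.
set e := expR (2 * A x) in hK E e0.
(* Put y = - A x, so that e (1 + 2 y) <= 1. If 2 y <= 1, then (1 - y) (1 + 2 y) >= 1 gives y <= 1 -
   e <= w. Otherwise e <= 1/2, so w >= 1/2 and y is at most the maximum times 2 w. *)
have [y1|y1] := leP (2 * - A x) 1.
  suff h : e <= 1 - - A x by have := mulr_ge0 m0 Kx0; lra.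
  rewrite -(ler_pM2r (ltac:(lra) : 0 < 1 + 2 * - A x)); apply: le_trans E _.
  have := mulr_ge0 (ltac:(lra) : 0 <= - A x) (ltac:(lra) : 0 <= 1 - 2 * - A x); lra.
have h2 : 2 <= 1 + 2 * - A x by lra.
have := ler_wpM2l (ltW e0) h2 => h3.
have h : 0 <= w - 2^-1 by lra.
have := mulr_ge0 m0 h; lra.
Qed.

End regular_exponent.

(** * Uniform tameness of rescaled marginals *)

Section levy_tame.
Context (R : realType) d (T : measurableType d) (P : probability T R).
Variables (L : R -> {RV P >-> R}) (A B : R -> R) (Cs : R).
Hypothesis EcosL : forall t xi, 0 <= t ->
  Ecos P (L t) xi = expR (t * A xi) * cos (t * B xi).
Hypothesis EsinL : forall t xi, 0 <= t ->
  Esin P (L t) xi = expR (t * A xi) * sin (t * B xi).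
Hypothesis Cs0 : 0 < Cs.
Hypothesis sector : forall xi, `|B xi| <= Cs * `|A xi|.
Variables (al g r K0 q : R).
Hypotheses (al0 : 0 < al) (g0 : 0 < g) (q0 : 0 < q) (qal : q <= al) (r1 : 1 <= r).
Hypothesis large : forall x, r <= x -> g / 2 * x `^ al <= `|A x| <= 2 * g * x `^ al.
Hypothesis K00 : 0 <= K0.
Hypothesis small : forall x, 0 <= x -> x <= r -> `|A x| <= K0 * x `^ q.

(** Two uses share this statement: a fixed time, with s = 1 and th = tau = t, and all rescaled
    marginals at once, with s = t^(-H) and th = tau = 1. For s xi >= r, t |A(s xi)| is comparable to
    g th xi^al, because t (s xi)^al = th xi^al; for s xi <= r it is at most K0 tau xi^q, because t
    s^q <= tau. *)
Lemma levy_tame (th tau : R) : 0 < th -> exists K, forall t s,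
  0 < t -> t <= tau -> 0 < s -> t * s `^ al = th -> t * s `^ q <= tau ->
  tame K (q / 2) P (scale_mfun s (L t)).
Proof.
move=> th0.
have A_le0 := exponent_le0 EcosL EsinL.
have kp0 : 0 < g / 2 * th by rewrite mulr_gt0// divr_gt0.
have [K1 hK1] := stretched_expR_le kp0 al0.
have K10 : 0 <= K1.
  by have := hK1 0 (lexx _); rewrite expr0n addr0 divr1; apply: le_trans; exact: expR_ge0.
(* M pays for the frequencies with s xi < r, where only A <= 0 is used: there (g/2) t (s xi)^al <=
   M. *)
pose M := g / 2 * (tau * r `^ al).
(* The absolute value of [tau] makes sense of the constant before t is given; positivity of [tau]
   follows from 0 < t <= tau. *)
exists (expR M * K1 + (1 + Cs) * (K0 * `|tau| + 2 * g * th)) => t s t0 ttau s0 tsal tsq.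
have tau0 : 0 < tau by exact: lt_le_trans ttau.
rewrite (gtr0_norm tau0).
have K20 : 0 <= (1 + Cs) * (K0 * tau + 2 * g * th).
  by rewrite mulr_ge0// ?addr_ge0// ?mulr_ge0// ltW.
split=> [xi xi0|u u0].
  have dec : expR (t * A (s * xi)) <= expR M * K1 / (1 + xi ^+ 2).
    apply: (@le_trans _ _ (expR M * expR (- (g / 2 * th * xi `^ al)))); last first.
      by rewrite -[leRHS]mulrA ler_wpM2l ?expR_ge0// hK1.
    rewrite -expRD ler_expR.
    have E : g / 2 * th * xi `^ al = g / 2 * (t * (s * xi) `^ al).
      by rewrite -tsal powRM ?(ltW s0)//; ring.
    rewrite E; have [rs|rs] := leP r (s * xi).
      have /andP[h _] := large rs; rewrite ler0_norm// in h.
      have M0 : 0 <= M by rewrite mulr_ge0 ?divr_ge0 ?(ltW g0)// mulr_ge0 ?(ltW tau0)// powR_ge0.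
      have := ler_wpM2l (ltW t0) h; lra.
    have h1 : t * A (s * xi) <= 0 by rewrite mulr_ge0_le0// ltW.
    have h2 : t * (s * xi) `^ al <= tau * r `^ al.
      apply: ler_pM; rewrite ?(ltW t0) ?powR_ge0//.
      apply: ge0_ler_powR (ltW rs); first exact: ltW.
        by rewrite nnegrE mulr_ge0// ltW.
      by rewrite nnegrE; exact: le_trans ler01 r1.
    have g2 : 0 <= g / 2 by rewrite divr_ge0// ltW.
    have := ler_wpM2l g2 h2; rewrite -/M; lra.
  have dK : expR M * K1 / (1 + xi ^+ 2) <=
      (expR M * K1 + (1 + Cs) * (K0 * tau + 2 * g * th)) / (1 + xi ^+ 2).
    by rewrite ler_wpM2r ?lerDl// invr_ge0 addr_ge0// sqr_ge0.
  rewrite Ecos_scale Esin_scale EcosL ?EsinL ?(ltW t0)// !normrM.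
  rewrite !(ger0_norm (expR_ge0 _)).
  have e0 := expR_ge0 (t * A (s * xi)).
  split; apply: le_trans (le_trans dec dK); rewrite ler_piMr//.
    exact: norm_cos_le1.
  exact: norm_sin_le1.
rewrite Ecos_scale; set xi := expR (- u).
have xi0 : 0 < xi by exact: expR_gt0.
have xi1 : xi <= 1 by rewrite -[leRHS]expR0 ler_expR oppr_le0.
have -> : expR (- (2 * (q / 2) * u)) = xi `^ q.
  rewrite /powR gt_eqF// /xi expRK; congr expR; by field.
have xq0 : 0 <= xi `^ q by exact: powR_ge0.
apply: le_trans (onem_EcosL_le EcosL EsinL sector _ (ltW t0)) _.
rewrite [leRHS]mulrDl; apply: ler_wpDl.
  by rewrite mulr_ge0// mulr_ge0// expR_ge0.
rewrite -[leRHS]mulrA; apply: ler_wpM2l; first by rewrite addr_ge0// ltW.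
have [rs|rs] := leP (s * xi) r.
  have h := small (mulr_ge0 (ltW s0) (ltW xi0)) rs.
  have h1 := ler_wpM2l (ltW t0) h.
  have E : t * (K0 * (s * xi) `^ q) = K0 * (t * s `^ q * xi `^ q).
    by rewrite powRM ?(ltW s0) ?(ltW xi0)//; ring.
  have h2 : K0 * (t * s `^ q * xi `^ q) <= K0 * (tau * xi `^ q).
    by rewrite ler_wpM2l// ler_wpM2r.
  have h3 : 0 <= 2 * g * th * xi `^ q by rewrite !mulr_ge0// ltW.
  move: h1; rewrite E => h1; lra.
have /andP[_ h] := large (ltW rs).
have h1 := ler_wpM2l (ltW t0) h.
have E : t * (2 * g * (s * xi) `^ al) = 2 * g * th * xi `^ al.
  by rewrite powRM ?(ltW s0) ?(ltW xi0)// -tsal; ring.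
have h2 : xi `^ al <= xi `^ q by apply: ger_powR => //; rewrite xi0.
have h3 : 2 * g * th * xi `^ al <= 2 * g * th * xi `^ q.
  by rewrite ler_wpM2l// !mulr_ge0// ltW.
have h4 : 0 <= K0 * tau * xi `^ q by rewrite !mulr_ge0// ltW.
move: h1; rewrite E => h1; lra.
Qed.

End levy_tame.

(** * The theorem *)

Section limit_process.
Context (R : realType) d d' (T : measurableType d) (T' : measurableType d')
  (P : probability T R) (Q : probability T' R).

Lemma process_cvg_marginal (X : R -> R -> T -> R) (Y : R -> T' -> R) (f : R -> R) (t : R) :
  process_cvg_in_law P X Q Y -> continuous f -> (exists M, forall x, `|f x| <= M) ->
  0 <= t ->
  \int[P]_w f (X a t w) @[a --> +oo] --> \int[Q]_w f (Y t w).
Proof.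
move=> XY cf [M fM] t0.
have := XY 1%N (fun=> t) (fun=> t0) (fun v => f (v ord0 ord0)).
have -> : (fun a => \int[P]_w f ((\row_(_ < 1) X a t w) ord0 ord0)) =
    (fun a => \int[P]_w f (X a t w)).
  by apply/funext => a; apply: eq_Rintegral => w _; rewrite mxE.
have -> : \int[Q]_w f ((\row_(_ < 1) Y t w) ord0 ord0) = \int[Q]_w f (Y t w).
  by apply: eq_Rintegral => w _; rewrite mxE.
apply; last by exists M => v.
move=> v; apply: (@continuous_comp _ _ _ (fun v : 'rV[R]_1 => v ord0 ord0) f).
  exact: coord_continuous.
exact: cf.
Qed.

(** The one-dimensional marginal gives Y_t and - Y_t the same law, while the sine is odd, so the
    quantity equals its opposite. *)
Lemma symmetric_Esin (Y : R -> {RV Q >-> R}) (t xi : R) :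
  symmetric_process Q Y -> 0 <= t -> Esin Q (Y t) xi = 0.
Proof.
move=> symY t0.
have law A : measurable A -> Q (Y t @^-1` A) = Q ((\- Y t)%R @^-1` A).
  move=> mA; have := symY 1%N (fun=> t) (fun=> t0) ((fun v => tnth v ord0) @^-1` A).
  have -> : (fun w => [tuple Y t w | _ < 1]) @^-1` ((fun v => tnth v ord0) @^-1` A) = Y t @^-1` A.
    by apply/seteqP; split=> w /=; rewrite tnth_mktuple.
  have -> : (fun w => [tuple - Y t w | _ < 1]) @^-1` ((fun v => tnth v ord0) @^-1` A) = (\- Y t)%R @^-1` A.
    by apply/seteqP; split=> w /=; rewrite tnth_mktuple.
  by apply; rewrite -[X in measurable X]setTI; exact: measurable_tnth.
have E : Esin Q (Y t) xi = Esin Q (\- Y t)%R xi.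
  have ms : measurable_fun setT (fun y : R => (sin (xi * y))%:E).
    apply/measurable_EFinP; apply: (continuous_measurable measurableT).
    have -> : (fun y : R => sin (xi * y)) = (fun y => sin (y * xi)).
      by apply/funext => y; rewrite mulrC.
    exact: continuous_sinM.
  rewrite /Esin /Rintegral; congr fine.
  rewrite -(@integral_distribution _ _ _ _ _ Q (Y t) (fun y => (sin (xi * y))%:E))//; last first.
    exact: integrable_sinX.
  rewrite -(@integral_distribution _ _ _ _ _ Q (\- Y t)%R (fun y => (sin (xi * y))%:E))//; last first.
    exact: (integrable_sinX (\- Y t)%R xi).
  by apply: eq_measure_integral => A mA _; exact: law.
have : Esin Q (\- Y t)%R xi = - Esin Q (Y t) xi.
  rewrite -EsinN; apply: eq_Rintegral => w _; congr sin.
  by rewrite mulrN mulNr.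
by rewrite -E; lra.
Qed.

End limit_process.

Lemma tameW (R : realType) d (T : measurableType d) (P : probability T R)
    (X : T -> R) (K K' r : R) : K <= K' -> tame K r P X -> tame K' r P X.
Proof.
move=> KK' [dX sX]; split=> [xi xi0|u u0].
  have h : K / (1 + xi ^+ 2) <= K' / (1 + xi ^+ 2).
    by rewrite ler_wpM2r// invr_ge0 addr_ge0// sqr_ge0.
  by have [h1 h2] := dX _ xi0; split; apply: le_trans h.
by apply: le_trans (sX _ u0) _; rewrite ler_wpM2r ?expR_ge0.
Qed.

(* The square never vanishes, so the continuous function Ecos Q Y keeps the
   sign it has at 0. *)
Lemma Ecos_stable (R : realType) d (T : measurableType d) (Q : probability T R)
    (Y : {RV Q >-> R}) (al g : R) : 0 < al ->
  (forall xi, 0 < xi -> Ecos Q Y xi ^+ 2 = expR (- (2 * (g * xi `^ al)))) ->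
  forall xi, Ecos Q Y xi = expR (- (g * `|xi| `^ al)).
Proof.
move=> al0 sqrY.
have pos xi : 0 <= xi -> 0 < Ecos Q Y xi.
  rewrite le_eqVlt => /predU1P[<-|xi0]; first by rewrite Ecos0.
  rewrite ltNge; apply/negP => neg.
  have [|x + x0] := @IVT _ (Ecos Q Y) 0 xi 0 (ltW xi0)
      (continuous_subspaceT (@continuous_Ecos _ _ _ Q Y)).
    by rewrite Ecos0 min_r ?neg ?max_l ?ler01// (le_trans neg).
  rewrite in_itv/= => /andP[]; rewrite le_eqVlt => /predU1P[x00 _|xx0 _].
    by move: x0; rewrite -x00 Ecos0 => /eqP; rewrite oner_eq0.
  have := sqrY _ xx0; rewrite x0 expr0n/= => /eqP.
  by rewrite eq_sym gt_eqF// expR_gt0.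
have main xi : 0 <= xi -> Ecos Q Y xi = expR (- (g * xi `^ al)).
  move=> xi0; have p := pos _ xi0.
  move: xi0; rewrite le_eqVlt => /predU1P[<-|xi0].
    by rewrite Ecos0 powR0 ?gt_eqF// mulr0 oppr0 expR0.
  apply: (@pexpIrn _ 2) => //; rewrite ?nnegrE ?expR_ge0 ?(ltW p)//.
  by rewrite sqrY// [RHS]expr2 -expRD; congr expR; ring.
move=> xi; rewrite -main//; have [_|_] := ger0P xi => //.
by rewrite EcosN.
Qed.

Lemma charfun_exponent (R : realType) d (T : measurableType d) (P : probability T R)
    (X : T -> R) (t xi : R) (z : R[i]) : charfun P X xi = cexp (t%:C%C * z) ->
  Ecos P X xi = expR (t * complex.Re z) * cos (t * complex.Im z) /\
  Esin P X xi = expR (t * complex.Re z) * sin (t * complex.Im z).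
Proof.
rewrite /charfun /cexp -/(Ecos P X xi) -/(Esin P X xi).
by case: z => a b /= [-> ->]; rewrite !mul0r subr0 addr0.
Qed.

Unset Implicit Arguments.
Set Strict Implicit.

Theorem theorem4p3 (R : realType)
    (d : measure_display) (T : measurableType d) (P : probability T R)
    (L : R -> {RV P >-> R}) (Psi : R -> complex R)
    (d' : measure_display) (T' : measurableType d') (Q : probability T' R)
    (H : R) (Y : R -> {RV Q >-> R}) (beta : R) :
  levy_process L ->
  characteristic_exponent L Psi ->
  sector_condition Psi ->
  LSS L H Y ->
  beta = BG_index Psi ->
  0 < beta <= 2 ->
  (exists2 p : R, 0 < p & ('E_P[fun w => (`|L 1 w| `^ p)%R] < +oo)%E) ->
  [/\ forall t : R, 0 < t -> finite_entropy (L t),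
      SaS Q beta (Y 1) /\ finite_entropy (Y 1) &
      exists2 o : R -> R, o t @[t --> 0^'+] --> (0 : R) &
        forall t : R, 0 < t ->
          entropy (L t) =
          beta^-1 * ln t + entropy (Y 1) + o t].
Proof.
move=> _ [_ LPsi] [Cs Cs0 sectorPsi] [[cvgY ntY] symY] betaE /andP[beta0 beta2] [p p0 Lp].
pose A xi := complex.Re (Psi xi); pose B xi := complex.Im (Psi xi).
have EcosL t xi : 0 <= t -> Ecos P (L t) xi = expR (t * A xi) * cos (t * B xi).
  by move=> t0; have [] := charfun_exponent (LPsi t xi t0).
have EsinL t xi : 0 <= t -> Esin P (L t) xi = expR (t * A xi) * sin (t * B xi).
  by move=> t0; have [] := charfun_exponent (LPsi t xi t0).
have A_le0 := exponent_le0 EcosL EsinL.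
have cvgC t xi : 0 <= t ->
    Ecos P (L (t / a)) (a `^ H * xi) @[a --> +oo] --> Ecos Q (Y t) xi.
  move=> t0.
  have -> : (fun a => Ecos P (L (t / a)) (a `^ H * xi)) =
      (fun a => \int[P]_w cos (xi * (a `^ H * L (t / a) w))).
    by apply/funext => a; apply: eq_Rintegral => w _; congr cos; ring.
  apply: (process_cvg_marginal (f := fun x => cos (xi * x)) cvgY) => //.
    have -> : (fun x : R => cos (xi * x)) = (fun x => cos (x * xi)).
      by apply/funext => x; rewrite mulrC.
    exact: continuous_cosM.
  by exists 1 => x; exact: norm_cos_le1.
have cvgS t xi : 0 <= t ->
    Esin P (L (t / a)) (a `^ H * xi) @[a --> +oo] --> Esin Q (Y t) xi.
  move=> t0.
  have -> : (fun a => Esin P (L (t / a)) (a `^ H * xi)) =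
      (fun a => \int[P]_w sin (xi * (a `^ H * L (t / a) w))).
    by apply/funext => a; apply: eq_Rintegral => w _; congr sin; ring.
  apply: (process_cvg_marginal (f := fun x => sin (xi * x)) cvgY) => //.
    have -> : (fun x : R => sin (xi * x)) = (fun x => sin (x * xi)).
      by apply/funext => x; rewrite mulrC.
    exact: continuous_sinM.
  by exists 1 => x; exact: norm_sin_le1.
have EsinY t xi : 0 <= t -> Esin Q (Y t) xi = 0 by exact: symmetric_Esin.
have H0 : 0 < H := H_gt0 EcosL EsinL sectorPsi cvgC ntY.
have [g g0 asympA] := exponent_asymp EcosL EsinL sectorPsi cvgC cvgS EsinY ntY.
have iH0 : 0 < H^-1 by rewrite invr_gt0.
have betaH : beta = H^-1.
  rewrite betaE; apply: (BG_indexE A_le0 _ iH0 g0 asympA Cs0) => //.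
  exact: exponentN EcosL EsinL.
have Hbeta : H = beta^-1 by rewrite betaH invrK.
rewrite -betaH in asympA.
have [r r1 large] := asymp_bounds A_le0 g0 asympA.
(* The bound p is for integrability of |L_1|^q, 1 for the inequality 1 - cos y <= 2 |y|^q and for
   q/2 < 1, beta for uniformity in t and for xi^beta <= xi^q on ]0, 1]. *)
pose q := Num.min (Num.min p 1) beta.
have q0 : 0 < q by rewrite !lt_min p0 ltr01.
have qb : q <= beta by rewrite ge_min lexx orbT.
have q1 : q <= 1 by rewrite !ge_min lexx orbT.
have qp : q <= p by rewrite !ge_min lexx.
have [K1 K10 mom] := onem_Ecos_le_moment p0 q0 qp q1 Lp.
have [K0 K00 small] : exists2 K', 0 <= K' &
    forall x, 0 <= x -> x <= r -> `|A x| <= K' * x `^ q.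
  (* The factor 2: with c the real part of phi, 1 - |phi|^2 <= 1 - c^2 = 2 (1 - c) - (1 - c)^2 <= 2
     (1 - c). *)
  apply: (exponent_le_near0 (K := 2 * K1) A_le0 (continuous_exponent EcosL EsinL)).
    exact: le_trans ler01 r1.
  move=> x x0; have := EcosEsin_sqr EcosL EsinL x ler01; rewrite mul1r => <-.
  have h1 := mom x x0; have h2 := sqr_ge0 (Esin P (L 1) x).
  have h3 := Ecos_le1 (L 1) x.
  have := norm_Ecos_le1 (L 1) x; rewrite ler_norml => /andP[h4 _].
  have := mulr_ge0 (ltac:(lra) : 0 <= 1 - Ecos P (L 1) x) (ltac:(lra) : 0 <= 1 - Ecos P (L 1) x).
  lra.
have tameL := levy_tame EcosL EsinL Cs0 sectorPsi beta0 g0 qb r1 large K00 small.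
have r0 : 0 < q / 2 by rewrite divr_gt0.
have r1' : q / 2 < 1 by lra.
have tameLt t : 0 < t -> exists K, tame K (q / 2) P (L t).
  move=> t0; have [K hK] := tameL t t t0; exists K.
  have -> : (L t : T -> R) = scale_mfun 1 (L t).
    by apply/funext => w; rewrite /= mulr1.
  by apply: hK => //; rewrite powR1 mulr1.
(* The squared modulus has two limits, one from convergence in law and one from the asymptotics of
   [A] along a^H xi; they must agree. *)
have sqrY xi : 0 < xi -> Ecos Q (Y 1) xi ^+ 2 = expR (- (2 * (g * xi `^ beta))).
  move=> xi0.
  have h1 : expR (2 * (A (a `^ H * xi) / a)) @[a --> +oo] --> Ecos Q (Y 1) xi ^+ 2.
    exact: (cvg_exponent_sqr EcosL EsinL cvgC cvgS EsinY).
  apply: (cvg_unique _ h1) => //.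
  have cy : a `^ H * xi @[a --> +oo] --> +oo.
    by apply: gt0_cvgMly => //; exact: cvgy_powR.
  have h2 : expR (2 * (A (a `^ H * xi) / (a `^ H * xi) `^ beta * xi `^ beta))
      @[a --> +oo] --> expR (2 * (- g * xi `^ beta)).
    apply: continuous_cvg; first exact: continuous_expR.
    apply: cvgMl_tmp; apply: cvgMr_tmp.
    exact: (cvg_comp _ (fun b => A b / b `^ beta) cy asympA).
  rewrite (_ : - (2 * (g * xi `^ beta)) = 2 * (- g * xi `^ beta)); last by ring.
  apply: cvg_trans h2; apply: near_eq_cvg; near=> a.
  have a0 : 0 < a by near: a; exact: nbhs_pinfty_gt.
  congr (expR (2 * _)); rewrite powRM ?powR_ge0 ?(ltW xi0)//.
  rewrite -powRrM betaH mulfV ?gt_eqF// powRr1 ?(ltW a0)//.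
  by rewrite invfM mulrA divfK// gt_eqF// powR_gt0.
have EcosY := Ecos_stable beta0 sqrY.
have [KY tameY] : exists K, tame K (q / 2) Q (Y 1).
  (* The summand |K| serves the decay, and g serves the clause near 0 through 1 - e^(-g xi^beta) <=
     g xi^beta <= g xi^q. *)
  have [K hK] := stretched_expR_le g0 beta0; exists (`|K| + g).
  split=> [xi xi0|u u0].
    have le0 : 0 <= (1 + xi ^+ 2)^-1 by rewrite invr_ge0 addr_ge0// sqr_ge0.
    rewrite EsinY// normr0 EcosY !(ger0_norm (expR_ge0 _), ger0_norm xi0); split.
      apply: le_trans (hK _ xi0) _; rewrite ler_wpM2r//.
      by rewrite (le_trans (ler_norm _))// lerDl ltW.
    by rewrite mulr_ge0// addr_ge0// ltW.
  rewrite EcosY (ger0_norm (expR_ge0 _)); set xi := expR (- u).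
  have xi1 : xi <= 1 by rewrite -[leRHS]expR0 ler_expR oppr_le0.
  have -> : expR (- (2 * (q / 2) * u)) = xi `^ q.
    by rewrite /powR gt_eqF ?expR_gt0// /xi expRK; congr expR; field.
  have h1 : xi `^ beta <= xi `^ q by apply: ger_powR => //; rewrite expR_gt0.
  have h2 := ler_wpM2l (ltW g0) h1; have h3 := expR_ge1Dx (- (g * xi `^ beta)).
  have h4 : 0 <= `|K| * xi `^ q by rewrite mulr_ge0// powR_ge0.
  lra.
have [KZ tameZ] : exists K, forall t, 0 < t -> t <= 1 ->
    tame K (q / 2) P (scale_mfun (t^-1 `^ H) (L t)).
  have [K hK] := tameL 1 1 ltr01; exists K => t t0 t1.
  have it0 : 0 < t^-1 by rewrite invr_gt0.
  apply: hK => //; first exact: powR_gt0.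
    by rewrite -powRrM Hbeta mulVf ?gt_eqF// powRr1 ?(ltW it0)// mulfV// gt_eqF.
  (* The condition t s^q <= 1 becomes (1/t)^(q/beta) <= 1/t, true since 1/t >= 1 and q <= beta. *)
  rewrite -powRrM -ler_pdivlMl// mulr1 -[leRHS]powRr1 ?(ltW it0)//.
  apply: ler_powR; first by rewrite invf_ge1.
  by rewrite Hbeta ler_pdivrMl// mulr1.
split.
- by move=> t t0; have [K tL] := tameLt t t0; exact: tame_finite_entropy tL.
- split; last exact: tame_finite_entropy tameY.
  split; first by rewrite beta0.
  exists g => // xi; rewrite /charfun -/(Ecos Q (Y 1) xi) -/(Esin Q (Y 1) xi).
  by rewrite EsinY// EcosY.
(* The remainder is defined by the expansion itself, so only its limit at 0 has content; it is
   computed along positive sequences u. *)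
exists (fun t => entropy (L t) - beta^-1 * ln t - entropy (Y 1)); last first.
  by move=> t t0; ring.
apply/cvg_at_rightP => u [u0 ucvg].
(* Uniform tameness is known for times at most 1 but required at every index; since u tends to 0,
   truncating it at 1 changes finitely many terms. *)
have tZ n : tame (Num.max KZ KY) (q / 2) P
    (scale_mfun ((Num.min (u n) 1)^-1 `^ H) (L (Num.min (u n) 1))).
  apply: (@tameW _ _ _ _ _ KZ); first by rewrite le_max lexx.
  by apply: tameZ; [rewrite lt_min u0 ltr01|rewrite ge_min lexx orbT].
have tY : tame (Num.max KZ KY) (q / 2) Q (Y 1).
  by apply: tameW tameY; rewrite le_max lexx orbT.
have ule1 : \forall n \near \oo, u n <= 1 by apply: (cvgr_le _ ucvg).
have iu : (u n)^-1 @[n --> \oo] --> +oo.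
  by apply: (proj2 (@cvgrVy _ _ _ _ u _)) => //; exact: nearW.
have cC xi : 0 <= xi -> Ecos P (scale_mfun ((Num.min (u n) 1)^-1 `^ H)
    (L (Num.min (u n) 1))) xi @[n --> \oo] --> Ecos Q (Y 1) xi.
  move=> _; have := cvg_comp _ _ iu (cvgC 1 xi ler01); apply: cvg_trans.
  apply: near_eq_cvg; apply: filterS ule1 => n un1 /=.
  by rewrite Ecos_scale min_l// div1r invrK.
have cS xi : 0 <= xi -> Esin P (scale_mfun ((Num.min (u n) 1)^-1 `^ H)
    (L (Num.min (u n) 1))) xi @[n --> \oo] --> Esin Q (Y 1) xi.
  move=> _; have := cvg_comp _ _ iu (cvgS 1 xi ler01); apply: cvg_trans.
  apply: near_eq_cvg; apply: filterS ule1 => n un1 /=.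
  by rewrite Esin_scale min_l// div1r invrK.
have cE := tame_entropy_cvg r0 r1' tZ tY cC cS.
rewrite -[X in _ --> X](subrr (entropy (Y 1))).
apply: cvgB; last exact: cvg_cst.
apply: cvg_trans cE; apply: near_eq_cvg; apply: filterS ule1 => n un1.
rewrite min_l//; have [K tL] := tameLt _ (u0 n).
have c0 : 0 < (u n)^-1 `^ H by rewrite powR_gt0// invr_gt0.
(* The scaling factor is u^(-H), whose logarithm - H ln u is exactly the term - (1/beta) ln u of the
   remainder. *)
rewrite (entropy_scale c0 (fdens_is_density (proj1 tL))); last first.
  exact: integrable_xlnx_fdens tL.
by rewrite ln_powR lnV ?posrE// Hbeta mulrN.
Unshelve. all: by end_near. Qed.
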